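(* Let $m\ge1$ be an integer and $\mathbb{T}^m=\mathbb{R}^m/\mathbb{Z}^m$. For $\boldsymbol{\alpha},\mathbf{v}\in\mathbb{T}^m$, $b>0$ and $N\in\mathbb{N}$, let $$S_{b,N}(\boldsymbol{\alpha}) := \#\left\{1\le q\le N : \|q\boldsymbol{\alpha}\|_{\mathbb{Z}} < bq^{-1/m}\right\},\qquad S_{b,N}(\boldsymbol{\alpha},\mathbf{v}) := \#\left\{1\le q\le N : \|q\boldsymbol{\alpha}-\mathbf{v}\|_{\mathbb{Z}} < bq^{-1/m}\right\},$$ where $q$ ranges over integers. Then for each $b>0$ and almost every $\boldsymbol{\alpha}\in\mathbb{T}^m$, $$\lim_{N\to\infty}\frac{S_{b,N}(\boldsymbol{\alpha})}{b^mB_m\log N}=1,$$ and, for each $b>0$, almost every $\boldsymbol{\alpha}\in\mathbb{T}^m$, and almost every $\mathbf{v}\in\mathbb{T}^m$, $$\lim_{N\to\infty}\frac{S_{b,N}(\boldsymbol{\alpha},\mathbf{v})}{b^mB_m\log N}=1.$$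
   Context: $\|\mathbf{x}\|_{\mathbb{Z}}=\min\{\|\mathbf{x}-\mathbf{p}\| : \mathbf{p}\in\mathbb{Z}^m\}$, where $\|\cdot\|$ is the Euclidean norm on $\mathbb{R}^m$; this is well defined on $\mathbb{T}^m$. $B_m$ denotes the volume of the Euclidean unit ball in $\mathbb{R}^m$. ''Almost every'' is with respect to Lebesgue (Haar) measure on $\mathbb{T}^m$. *)

(* Defs.v *)
From HB Require Import structures.
From mathcomp Require Import all_boot all_order all_algebra.
From mathcomp Require Import generic_quotient ring_quotient.
From mathcomp Require Import all_classical all_reals all_analysis.
From mathcomp Require Import measurable_realfun ring lra.
Set Implicit Arguments.
Unset Strict Implicit.
Unset Printing Implicit Defensive.
Import Order.TTheory GRing.Theory Num.Theory.
Import numFieldNormedType.Exports.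
Local Open Scope classical_set_scope.
Local Open Scope ring_scope.
Local Open Scope quotient_scope.

Definition rV_display : measure_display -> measure_display.
Proof. exact. Qed.

Section measurable_rV.
Context {R : realType} (m : nat).

Definition rV_coord (i : 'I_m) (x : 'rV[R]_m) : measurableTypeR R := x ord0 i.

Let rV_set0 : g_sigma_preimage rV_coord set0.
Proof. exact: sigma_algebra0. Qed.

Let rV_setC A : g_sigma_preimage rV_coord A -> g_sigma_preimage rV_coord (~` A).
Proof. exact: sigma_algebraC. Qed.

Let rV_bigcup (F : _^nat) : (forall i, g_sigma_preimage rV_coord (F i)) ->
  g_sigma_preimage rV_coord (\bigcup_i (F i)).
Proof. exact: sigma_algebra_bigcup. Qed.

(* The product (= Borel) sigma-algebra of R^m, as for [n.-tuple T]. *)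
HB.instance Definition _ := @isMeasurable.Build
  (rV_display default_measure_display)
  'rV[R]_m (g_sigma_preimage rV_coord) rV_set0 rV_setC rV_bigcup.

Lemma measurable_rV_coord (i : 'I_m) : measurable_fun setT (rV_coord i).
Proof.
move=> _ Y mY; rewrite setTI; apply: sub_sigma_algebra => /=.
rewrite -bigcup_seq/=; exists i => /=; first by rewrite mem_index_enum.
by exists Y => //; rewrite setTI.
Qed.

Lemma measurable_fun_rV d (T : measurableType d) (f : T -> 'rV[R]_m) :
  (forall i, measurable_fun setT (rV_coord i \o f)) -> measurable_fun setT f.
Proof.
move=> mf; suff : g_sigma_preimage (fun i => rV_coord i \o f) `<=` measurable.
  by rewrite g_sigma_preimage_comp => fS _ A mA; apply: fS; exists A.
apply: smallest_sub; first exact: sigma_algebra_measurable.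
rewrite -bigcup_seq; apply: bigcup_sub => i _.
by move=> A [B mB <-]; exact: mf.
Qed.

End measurable_rV.

Section lebesgue_rV.
Context {R : realType}.

Definition rV_cons n (x : measurableTypeR R * 'rV[R]_n) : 'rV[R]_n.+1 :=
  row_mx ((x.1 : R)%:M : 'rV_1) x.2.

Definition rV_uncons n (x : 'rV[R]_n.+1) : measurableTypeR R * 'rV[R]_n :=
  (x ord0 ord0, rsubmx (x : 'rV_(1 + n))).

Lemma rV_cons0 n x : @rV_cons n x ord0 ord0 = x.1.
Proof.
have -> : (ord0 : 'I_n.+1) = lshift n (ord0 : 'I_1) by exact: val_inj.
by rewrite /rV_cons (@row_mxEl _ 1 1 n) mxE.
Qed.

Lemma rV_consS n x i : @rV_cons n x ord0 (lift ord0 i) = x.2 ord0 i.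
Proof.
have -> : lift ord0 i = rshift 1 i by exact: val_inj.
exact: (@row_mxEr _ 1 1 n).
Qed.

Lemma rV_consK n : cancel (@rV_cons n) (@rV_uncons n).
Proof.
by move=> [a x]; rewrite /rV_uncons rV_cons0/= /rV_cons row_mxKr.
Qed.

Lemma rV_unconsK n : cancel (@rV_uncons n) (@rV_cons n).
Proof.
move=> x; apply/rowP => i; case: (unliftP ord0 i) => [j|] ->.
  rewrite rV_consS mxE; congr (x _ _); exact: val_inj.
by rewrite rV_cons0.
Qed.

Lemma measurable_rV_cons n : measurable_fun setT (@rV_cons n).
Proof.
apply: measurable_fun_rV => i; case: (unliftP ord0 i) => [j|] ->.
- rewrite (_ : _ \o _ = rV_coord j \o snd); last first.
    by apply/funext => x /=; rewrite /rV_coord rV_consS.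
  by apply: measurableT_comp => //; exact: measurable_rV_coord.
- rewrite (_ : _ \o _ = fst)//.
  by apply/funext => x /=; rewrite /rV_coord rV_cons0.
Qed.

Lemma measurable_rV_uncons n : measurable_fun setT (@rV_uncons n).
Proof.
apply/measurable_fun_pairP; split.
  exact: measurable_rV_coord ord0.
apply: measurable_fun_rV => i.
rewrite (_ : _ \o _ = rV_coord (lift ord0 i)); first exact: measurable_rV_coord.
apply/funext => x /=; rewrite /rV_coord mxE; congr (x _ _); exact: val_inj.
Qed.

(* Lebesgue measure on R^m as an iterated product; R^0 is a point of mass 1. *)
Fixpoint lebesgue_rV (m : nat) : set 'rV[R]_m -> \bar R :=
  match m with
  | 0 => \d_(0 : 'rV[R]_0)
  | n.+1 => pushforward (lebesgue_measure \x @lebesgue_rV n)%E (@rV_cons n)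
  end.

Let is_sigma_finite_measure d (T : measurableType d) (nu : set T -> \bar R) :
  nu set0 = 0%E -> (forall A, 0 <= nu A)%E -> semi_sigma_additive nu ->
  sigma_finite setT nu ->
  exists mu : {sigma_finite_measure set T -> \bar R}, (mu : set T -> _) = nu.
Proof.
move=> nu0 nu_ge0 nu_add nu_sf.
pose M := isMeasure.Build _ _ _ nu nu0 nu_ge0 nu_add.
pose nuM : {measure set T -> \bar R} := HB.pack nu M.
pose S := Measure_isSigmaFinite.Build _ _ _ nuM nu_sf.
pose nuS : {sigma_finite_measure set T -> \bar R} := HB.pack nu M S.
by exists nuS.
Qed.

Lemma lebesgue_rV_sigma_finite_measure m :
  exists mu : {sigma_finite_measure set 'rV[R]_m -> \bar R},
    (mu : set _ -> _) = @lebesgue_rV m.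
Proof.
elim: m => [|n [mu muE]]; first by exists (\d_(0 : 'rV[R]_0)).
rewrite /= -muE; set nu := pushforward _ _.
have preT A : measurable A -> measurable (@rV_cons n @^-1` A).
  by move=> mA; rewrite -[X in measurable X]setTI; exact: measurable_rV_cons.
have nu0 : nu set0 = 0%E by exact: (measure0 (lebesgue_measure \x mu)%E).
have nu_ge0 A : (0 <= nu A)%E by exact: (measure_ge0 (lebesgue_measure \x mu)%E).
have nu_add : semi_sigma_additive nu.
  move=> F mF tF mUF; rewrite /nu /pushforward preimage_bigcup.
  apply: measure_semi_sigma_additive.
  - by move=> k; exact: preT.
  - apply/trivIsetP => /= i j _ _ ij; rewrite -preimage_setI.
    by move/trivIsetP : tF => /(_ _ _ _ _ ij) ->//; rewrite preimage_set0.
  - by rewrite -preimage_bigcup; exact: preT.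
have nu_sf : sigma_finite setT nu.
  have /sigma_finiteP[F [TF ndF Foo]] := sigma_finiteT (@lebesgue_measure R).
  have /sigma_finiteP[G [TG ndG Goo]] := sigma_finiteT mu.
  exists (fun k => @rV_uncons n @^-1` (F k `*` G k)).
    rewrite -preimage_bigcup (_ : \bigcup_k _ = setT) ?preimage_setT//.
    rewrite -subTset => -[x y] _.
    have [i _ Fx] : (\bigcup_k F k) x by rewrite -TF.
    have [j _ Gy] : (\bigcup_k G k) y by rewrite -TG.
    exists (maxn i j) => //; split.
    - by move: x Fx; exact/subsetPset/ndF/leq_maxl.
    - by move: y Gy; exact/subsetPset/ndG/leq_maxr.
  move=> k; have [mFk Fk] := Foo k; have [mGk Gk] := Goo k; split.
    rewrite -[X in measurable X]setTI; apply: measurable_rV_uncons => //.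
    exact: measurableX.
  rewrite /nu /pushforward -comp_preimage (_ : _ \o _ = id); last first.
    by apply/funext => x /=; rewrite rV_consK.
  by rewrite preimage_id product_measure1E// lte_mul_pinfty// ge0_fin_numE.
exact: is_sigma_finite_measure.
Qed.

Section instances.
Variable m : nat.

Let lebesgue_rV0 : @lebesgue_rV m set0 = 0%E.
Proof. by have [mu <-] := lebesgue_rV_sigma_finite_measure m. Qed.

Let lebesgue_rV_ge0 A : (0 <= @lebesgue_rV m A)%E.
Proof. by have [mu <-] := lebesgue_rV_sigma_finite_measure m. Qed.

Let lebesgue_rV_sigma_additive : semi_sigma_additive (@lebesgue_rV m).
Proof.
have [mu <-] := lebesgue_rV_sigma_finite_measure m.
exact: measure_semi_sigma_additive.
Qed.

HB.instance Definition _ := isMeasure.Build _ _ _ (@lebesgue_rV m)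
  lebesgue_rV0 lebesgue_rV_ge0 lebesgue_rV_sigma_additive.

Let lebesgue_rV_sigma_finite : sigma_finite setT (@lebesgue_rV m).
Proof.
by have [mu <-] := lebesgue_rV_sigma_finite_measure m; exact: sigma_finiteT.
Qed.

HB.instance Definition _ := Measure_isSigmaFinite.Build _ _ _ (@lebesgue_rV m)
  lebesgue_rV_sigma_finite.

End instances.

Lemma measurable_box m (A : 'I_m -> set (measurableTypeR R)) :
  (forall i, measurable (A i)) ->
  measurable [set x : 'rV[R]_m | forall i, A i (x ord0 i)].
Proof.
move=> mA; rewrite (_ : [set x | _] =
    \bigcap_(i in [set: 'I_m]) (rV_coord i @^-1` A i)); last first.
  by apply/seteqP; split => [x + i _|x + i]; apply.
apply: fin_bigcap_measurable => // i _.
by rewrite -[X in measurable X]setTI; exact: measurable_rV_coord.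
Qed.

Lemma lebesgue_rV_box m (A : 'I_m -> set (measurableTypeR R)) :
  (forall i, measurable (A i)) ->
  lebesgue_rV [set x : 'rV[R]_m | forall i, A i (x ord0 i)] =
  (\prod_(i < m) lebesgue_measure (A i))%E.
Proof.
elim: m A => [|n IH] A mA.
  rewrite big_ord0 /= /dirac indicE (_ : [set x | _] = setT) ?inE//.
    by rewrite in_setT.
  by apply/seteqP; split => // x _ [].
rewrite big_ord_recl -IH//.
rewrite -(@product_measure1E _ _ _ _ _ lebesgue_measure (@lebesgue_rV n))//; last first.
  by apply: (@measurable_box n (fun i => A (lift ord0 i))) => i; exact: mA.
rewrite /= /pushforward; congr (_ _); apply/seteqP; split => -[a x] /=.
  move=> H; split; first by have := H ord0; rewrite rV_cons0.
  by move=> i; have := H (lift ord0 i); rewrite rV_consS.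
move=> [Aa Ax] i; case: (unliftP ord0 i) => [j|] ->.
  by rewrite rV_consS; exact: Ax.
by rewrite rV_cons0.
Qed.

End lebesgue_rV.

Definition enorm (R : realType) (m : nat) (x : 'rV[R]_m) : R :=
  Num.sqrt (\sum_(i < m) x ord0 i ^+ 2).

Definition unit_ball_volume (R : realType) (m : nat) : R :=
  fine (lebesgue_rV [set x : 'rV[R]_m | enorm x <= 1]).

Lemma measurable_enorm (R : realType) (m : nat) :
  measurable_fun [set: 'rV[R]_m] (@enorm R m : _ -> measurableTypeR R).
Proof.
apply: (@measurable_comp _ _ _ _ _ _ setT (Num.sqrt : R -> R)) => //.
  by apply: continuous_measurable_fun; exact: sqrt_continuous.
apply: (@measurable_sum _ _ _ setT _ (index_enum 'I_m)
  (fun i (x : 'rV[R]_m) => (x ord0 i) ^+ 2)) => i.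
by apply: measurable_funX; exact: (measurable_rV_coord i).
Qed.

(* The ball has finite measure, so [fine] loses nothing. *)
Lemma unit_ball_volumeE (R : realType) (m : nat) :
  (unit_ball_volume R m)%:E = lebesgue_rV [set x : 'rV[R]_m | enorm x <= 1].
Proof.
have mB : measurable [set x : 'rV[R]_m | enorm x <= 1].
  rewrite (_ : [set x | _] = @enorm R m @^-1` `]-oo, 1%R]%classic); last first.
    by apply/seteqP; split => x /=; rewrite in_itv.
  by rewrite -[X in measurable X]setTI; exact: measurable_enorm.
pose A (i : 'I_m) : set (measurableTypeR R) := `[(-1)%R, 1%R]%classic.
have mA i : measurable (A i) by exact: measurable_itv.
rewrite /unit_ball_volume fineK// ge0_fin_numE//.
apply: (@le_lt_trans _ _
  (lebesgue_rV [set x : 'rV[R]_m | forall i, A i (x ord0 i)])).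
  apply: le_measure; rewrite ?inE//; first exact: measurable_box.
  move=> x /= x1 i; rewrite /A /= in_itv/= -ler_norml (le_trans _ x1)//.
  rewrite -sqrtr_sqr ler_wsqrtr// (bigD1 i)//= lerDl.
  by apply: sumr_ge0 => j _; exact: sqr_ge0.
rewrite lebesgue_rV_box// (eq_bigr (fun=> (1 - -1)%:E)); last first.
  move=> i _; rewrite /A lebesgue_measure_itv/= lte_fin.
  by rewrite (lt_trans (ltrN10 R))// -EFinB.
by rewrite prodEFin ltry.
Qed.

Definition Zlattice (R : realType) (m : nat) : {pred 'rV[R]_m} :=
  [pred x | x \is a mxOver Num.int].

Lemma Zlattice_zmod_closed (R : realType) (m : nat) :
  zmod_closed (@Zlattice R m).
Proof.
split; first exact: mxOver0.
move=> x y /mxOverP xZ /mxOverP yZ; apply/mxOverP => i j.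
by rewrite !mxE rpredB.
Qed.

HB.instance Definition _ (R : realType) (m : nat) :=
  GRing.isZmodClosed.Build 'rV[R]_m (@Zlattice R m)
    (@Zlattice_zmod_closed R m).

Definition torus_display : measure_display -> measure_display.
Proof. exact. Qed.

Definition torus (R : realType) (m : nat) : Type := Quotient.quot (@Zlattice R m).

Section torus.
Context {R : realType} (m : nat).
Local Notation T := (torus R m).

HB.instance Definition _ := GRing.Zmodule.on T.
HB.instance Definition _ := EqQuotient.copy T (Quotient.quot (@Zlattice R m)).
HB.instance Definition _ := isPointed.Build T 0.

Let projT_set0 : image_set_system setT (\pi_T : 'rV[R]_m -> T) measurable set0.
Proof. by rewrite /image_set_system/= preimage_set0 setI0. Qed.

Let projT_setC A : image_set_system setT (\pi_T : 'rV[R]_m -> T) measurable A ->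
  image_set_system setT (\pi_T : 'rV[R]_m -> T) measurable (~` A).
Proof.
by rewrite /image_set_system/= !setTI preimage_setC; exact: measurableC.
Qed.

Let projT_bigcup (F : _^nat) :
  (forall i, image_set_system setT (\pi_T : 'rV[R]_m -> T) measurable (F i)) ->
  image_set_system setT (\pi_T : 'rV[R]_m -> T) measurable (\bigcup_i (F i)).
Proof.
rewrite /image_set_system/= => mF; rewrite setTI preimage_bigcup.
by apply: bigcup_measurable => i _; have := mF i; rewrite setTI.
Qed.

(* The quotient sigma-algebra: the projection is a countable-to-one local
   homeomorphism, so these are exactly the Borel sets of the torus. *)
HB.instance Definition _ := @isMeasurable.Build
  (torus_display default_measure_display)
  T (image_set_system setT \pi_T measurable) projT_set0 projT_setC projT_bigcup.

Lemma measurable_pi_torus : measurable_fun setT (\pi_T : 'rV[R]_m -> T).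
Proof. by []. Qed.

Lemma pi_torus_eq (x y : 'rV[R]_m) :
  reflect (x - y \is a mxOver Num.int) (\pi_T x == \pi_T y).
Proof. by rewrite -(Quotient.idealrBE (@Zlattice R m)); exact: idP. Qed.

Definition unit_cube : set 'rV[R]_m := [set x | forall i, 0 <= x ord0 i < 1].

(* Pushforward to the torus of the Lebesgue measure on the fundamental domain
   [0, 1)^m. *)
Definition haar_torus (A : set T) : \bar R :=
  lebesgue_rV (unit_cube `&` \pi_T @^-1` A).

Lemma unit_cubeE : unit_cube =
  [set x | forall i, (`[0, 1[%classic : set (measurableTypeR R)) (x ord0 i)].
Proof. by apply/seteqP; split => x /= + i => /(_ i); rewrite in_itv. Qed.

Lemma measurable_unit_cube : measurable unit_cube.
Proof.
rewrite unit_cubeE.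
by apply: (@measurable_box R m (fun=> `[0, 1[%classic)) => i; exact: measurable_itv.
Qed.

Let mpre (A : set T) : measurable A -> measurable (unit_cube `&` \pi_T @^-1` A).
Proof.
move=> mA; apply: measurableI; first exact: measurable_unit_cube.
by rewrite -[X in measurable X]setTI; exact: measurable_pi_torus.
Qed.

Let haar_torus0 : haar_torus set0 = 0%E.
Proof. by rewrite /haar_torus preimage_set0 setI0 measure0. Qed.

Let haar_torus_ge0 A : (0 <= haar_torus A)%E.
Proof. exact: measure_ge0. Qed.

Let haar_torus_sigma_additive : semi_sigma_additive haar_torus.
Proof.
move=> F mF tF mUF; rewrite /haar_torus preimage_bigcup setI_bigcupr.
apply: measure_semi_sigma_additive.
- by move=> k; exact: mpre.
- apply/trivIset_setIl/trivIsetP => /= i j _ _ ij; rewrite -preimage_setI.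
  by move/trivIsetP : tF => /(_ _ _ _ _ ij) ->//; rewrite preimage_set0.
- by rewrite -setI_bigcupr -preimage_bigcup; exact: mpre.
Qed.

HB.instance Definition _ := isMeasure.Build _ _ _ haar_torus
  haar_torus0 haar_torus_ge0 haar_torus_sigma_additive.

Let haar_torus_setT : haar_torus setT = 1%E.
Proof.
rewrite /haar_torus preimage_setT setIT unit_cubeE.
rewrite (@lebesgue_rV_box R m (fun=> `[0, 1[%classic))//.
rewrite big1// => i _; rewrite lebesgue_measure_itv/= lte_fin ltr01.
by rewrite oppr0 adde0.
Qed.

HB.instance Definition _ := Measure_isProbability.Build _ _ _ haar_torus
  haar_torus_setT.

End torus.

Section torus_norm.
Context {R : realType} (m : nat).
Local Notation T := (torus R m).

(* The infimum is attained, see [norm_Z_min]. *)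
Definition norm_Z (x : 'rV[R]_m) : R :=
  inf [set enorm (x - p) | p in [set p | p \is a mxOver Num.int]].

(* Independent of the representative, see [torus_norm_pi]. *)
Definition torus_norm (x : T) : R := norm_Z (repr x).

Lemma norm_Z_min (x : 'rV[R]_m) : exists2 p, p \is a mxOver Num.int &
  norm_Z x = enorm (x - p) /\
  forall q, q \is a mxOver Num.int -> enorm (x - p) <= enorm (x - q).
Proof.
pose r (t : R) : R := (Num.floor (t + 2^-1))%:~R.
have rP t (q : R) : q \is a Num.int -> (t - r t) ^+ 2 <= (t - q) ^+ 2.
  case/intrP=> k ->; rewrite /r; set f := Num.floor _.
  have [f1 f2] : f%:~R <= t + 2^-1 /\ t + 2^-1 < f%:~R + 1.
    split; first exact: floor_le.
    by have := floorD1_gt (t + 2^-1); rewrite intrD.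
  have [->//|] := eqVneq k f; rewrite neq_lt => /orP[kf|fk].
    have : (k + 1)%:~R <= f%:~R :> R by rewrite ler_int lezD1.
    by rewrite intrD; nra.
  have : (f + 1)%:~R <= k%:~R :> R by rewrite ler_int lezD1.
  by rewrite intrD; nra.
pose p : 'rV[R]_m := \row_i r (x ord0 i).
have pZ : p \is a mxOver Num.int.
  by apply/mxOverP => i j; rewrite mxE; exact: intr_int.
have pmin q : q \is a mxOver Num.int -> enorm (x - p) <= enorm (x - q).
  move=> /mxOverP qZ; rewrite ler_wsqrtr//; apply: ler_sum => i _.
  by rewrite !mxE; exact: rP.
exists p => //; split => //; apply/eqP; rewrite eq_le; apply/andP; split.
  apply: ge_inf; last by exists p.
  by exists 0 => _ [q _ <-]; exact: sqrtr_ge0.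
apply: lb_le_inf; first by exists (enorm (x - p)), p.
by move=> _ [q qZ <-]; exact: pmin.
Qed.

Lemma norm_Z_mod (x y : 'rV[R]_m) : x - y \is a mxOver Num.int ->
  norm_Z x = norm_Z y.
Proof.
move=> /mxOverP xyZ; rewrite /norm_Z; congr inf.
apply/seteqP; split=> _ [p /mxOverP pZ <-].
  exists (p - (x - y)).
    by apply/mxOverP => i j; have := xyZ i j; rewrite !mxE => ?; rewrite rpredB.
  by congr enorm; apply/rowP => i; rewrite !mxE; ring.
exists (p + (x - y)).
  by apply/mxOverP => i j; have := xyZ i j; rewrite !mxE => ?; rewrite rpredD.
by congr enorm; apply/rowP => i; rewrite !mxE; ring.
Qed.

Lemma torus_norm_pi (x : 'rV[R]_m) : torus_norm (\pi_T x) = norm_Z x.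
Proof. by apply/norm_Z_mod/pi_torus_eq; rewrite reprK. Qed.

End torus_norm.

Definition hom_count (R : realType) (m : nat) (b : R) (N : nat) (alpha : torus R m) : nat :=
  count (fun q : nat => torus_norm (alpha *+ q) < b * q%:R `^ (- m%:R^-1))
    (iota 1 N).

Definition inhom_count (R : realType) (m : nat) (b : R) (N : nat) (alpha v : torus R m) : nat :=
  count (fun q : nat => torus_norm (alpha *+ q - v) < b * q%:R `^ (- m%:R^-1))
    (iota 1 N).

(* Main.v *)
Require Import Defs.
From HB Require Import structures.
From mathcomp Require Import all_boot all_order all_algebra.
From mathcomp Require Import generic_quotient ring_quotient.
From mathcomp Require Import all_classical all_reals all_analysis.
From mathcomp Require Import measurable_realfun ring lra zify.
Set Implicit Arguments.
Unset Strict Implicit.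
Unset Printing Implicit Defensive.
Import Order.TTheory GRing.Theory Num.Theory.
Import numFieldNormedType.Exports.
Local Open Scope classical_set_scope.
Local Open Scope ring_scope.
Local Open Scope quotient_scope.

(** The counts are sums of indicators of events of probability
    [c / q], with [c = b ^ m * B_m], for all large [q]: multiplication by [q]
    and translations preserve Haar measure on the torus, so each event has the
    measure of a ball.  The mean of the count up to [N] is therefore
    [c ln N + O(1)], and the theorem is a strong law of large numbers, proved
    by the second moment method along a sparse sequence of [N] and then
    extended to all [N] because the counts are nondecreasing
    ([ae_hits_equiv_log]).  What has to be shown is that the events are nearly
    pairwise independent.

    In the inhomogeneous problem, on pairs [(alpha, v)], they are exactly
    pairwise independent ([inhom_set_independent]), and Fubini turns almost
    every pair into almost every [v] for almost every [alpha].

    In the homogeneous problem let [q <= r] have gcd [g], and write [q = g a]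
    and [r = g n].  The point [g alpha] is again uniform, so one has to compare
    the conditions on its multiples by the coprime numbers [a] and [n].
    Averaging over the [n]-torsion of the torus shows that they are
    independent up to fattening a ball by the mesh [sqrt m / n] of the torsion
    grid ([haar_coprime_ball]).  This is harmless unless [n] is small
    compared with the inverse of the radius, in which case the two
    approximations of [alpha] are the same rational point
    ([coprime_close]).  For [m = 1] these repeated approximations really make
    the variance as large as the square of the mean.  They are removed by a
    truncation: one discards from the event of index [q] the points whose
    approximating integer vector has, together with [q], a common divisor
    larger than [D] ([hom_trunc]).  This costs a proportion [1 / D] of the
    mean ([sum_hom_truncD]), and it leaves correlations whose total excess is
    of order [D ln N] ([hom_overlap], [sum_overlap_err]).  Letting [D] grow
    like a small power of [ln N] makes both errors negligible. *)

(** * Measures on Euclidean space *)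

Lemma pushforward_measure d1 d2 (T1 : measurableType d1)
    (T2 : measurableType d2) (R : realType) (mu : {measure set T1 -> \bar R})
    (f : T1 -> T2) : measurable_fun setT f ->
  exists nu : {measure set T2 -> \bar R}, forall A, nu A = mu (f @^-1` A).
Proof.
by move=> mf; unshelve eexists (pushforward mu f : {measure set T2 -> \bar R}).
Qed.

Section euclidean_space.
Context {R : realType}.
Local Notation lam := (@lebesgue_measure R).

Lemma measurable_rVE m : (measurable : set (set 'rV[R]_m)) =
  <<s [set B | exists2 A : 'I_m -> set (measurableTypeR R),
         (forall i, measurable (A i)) &
         B = [set x : 'rV[R]_m | forall i, A i (x ord0 i)]] >>.
Proof.
apply/seteqP; split; last first.
  apply: smallest_sub; first exact: sigma_algebra_measurable.
  by move=> _ [A mA ->]; exact: measurable_box.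
apply: smallest_sub; first exact: smallest_sigma_algebra.
rewrite -bigcup_seq; apply: bigcup_sub => i _ _ [A mA <-].
apply: sub_sigma_algebra.
exists (fun j => if j == i then A else setT).
  by move=> j; case: ifP.
rewrite setTI; apply/seteqP; split => x /=; rewrite /rV_coord.
  by move=> Ax j; case: eqP => // ->.
by move=> /(_ i); rewrite eqxx.
Qed.

(** Boxes are stable under intersection and generate the sigma-algebra, so a
    measure is determined by its values on them.  Every change of variables
    in [R^m] below is thereby reduced to one on the line. *)
Lemma eq_measure_rV m (m1 m2 : {measure set 'rV[R]_m -> \bar R})
    (g : nat -> 'I_m -> set (measurableTypeR R)) :
  (forall k i, measurable (g k i)) ->
  \bigcup_k [set x : 'rV[R]_m | forall i, g k i (x ord0 i)] = setT ->
  (forall k, (m1 [set x : 'rV[R]_m | forall i, g k i (x ord0 i)]%R < +oo)%E) ->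
  (forall A : 'I_m -> set (measurableTypeR R), (forall i, measurable (A i)) ->
     m1 [set x : 'rV[R]_m | forall i, A i (x ord0 i)] =
     m2 [set x : 'rV[R]_m | forall i, A i (x ord0 i)]) ->
  forall E, measurable E -> m1 E = m2 E.
Proof.
move=> mg gT goo m12 E mE.
apply: (measure_unique _ _ (@measurable_rVE m) _ _ gT) => //.
- move=> _ _ [A mA ->] [B mB ->]; exists (fun i => A i `&` B i).
    by move=> i; exact: measurableI.
  apply/seteqP; split => x /=; first by move=> [Ax Bx] i; split.
  by move=> ABx; split=> i; have [] := ABx i.
- by move=> k; exists (g k).
- by move=> _ [A mA ->]; exact: m12.
Qed.

Lemma measurable_affine (r t : R) :
  measurable_fun setT (fun x : measurableTypeR R => r * x + t : measurableTypeR R).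
Proof.
apply: continuous_measurable_fun => x.
by apply: cvgD; [apply: cvgM; [exact: cvg_cst|exact: cvg_id]|exact: cvg_cst].
Qed.

Lemma lebesgue_measure_affine (r t : R) (A : set (measurableTypeR R)) :
  0 < r -> measurable A ->
  (r%:E * lam ((fun x => r * x + t)%R @^-1` A) = lam A)%E.
Proof.
move=> r0 mA.
have [nu nuE] := pushforward_measure lam (measurable_affine r t).
pose rr : {nonneg R} := NngNum (ltW r0).
rewrite -nuE; change (mscale rr nu A = lam A).
apply/esym/lebesgue_measure_unique => // _ [[a b]/= _ <-].
rewrite /mscale/= nuE (_ : _ @^-1` _ = `](a - t) / r, (b - t) / r]%classic).
  rewrite lebesgue_measure_itv/= lte_fin [in RHS]lebesgue_measure_itv/= lte_fin
    ltr_pM2r ?invr_gt0// ltrD2r.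
  case: ifP => _; last by rewrite mule0.
  by rewrite -!EFinD -EFinM; congr EFin; field; rewrite gt_eqF.
apply/seteqP; split => x /=; rewrite !in_itv/= ltr_pdivrMr// ler_pdivlMr//.
  by move=> /andP[H1 H2]; apply/andP; split; lra.
by move=> /andP[H1 H2]; apply/andP; split; lra.
Qed.

Lemma measurable_rV_affine m (r : R) (t : 'rV[R]_m) :
  measurable_fun setT (fun x : 'rV[R]_m => r *: x + t).
Proof.
apply: measurable_fun_rV => i.
rewrite (_ : _ \o _ = (fun x => r * x + t ord0 i) \o rV_coord i); last first.
  by apply/funext => x /=; rewrite /rV_coord !mxE.
apply: measurableT_comp; last exact: measurable_rV_coord.
exact: measurable_affine.
Qed.

Lemma lebesgue_rV_affine m (r : R) (t : 'rV[R]_m) (E : set 'rV[R]_m) :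
  0 < r -> measurable E ->
  ((r ^+ m)%:E * lebesgue_rV ((fun x => r *: x + t)%R @^-1` E) =
   lebesgue_rV E)%E.
Proof.
move=> r0 mE.
have [nu nuE] := pushforward_measure (@lebesgue_rV R m) (measurable_rV_affine r t).
pose rr : {nonneg R} := NngNum (exprn_ge0 m (ltW r0)).
rewrite -nuE; change (mscale rr nu E = lebesgue_rV E).
pose g (k : nat) (i : 'I_m) : set (measurableTypeR R) := `[- k%:R, k%:R]%classic.
apply/esym; apply: (@eq_measure_rV _ _ _ g) => //.
- by move=> k i; exact: measurable_itv.
- rewrite -subTset => x _.
  have [N NP] : exists N : nat, forall i, `|x ord0 i| <= N%:R.
    exists (\max_(i < m) (Num.bound (x ord0 i))) => i.
    rewrite (le_trans (ltW (archi_boundP _))) // ler_nat.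
    rewrite (_ : Num.bound _ = Num.bound (x ord0 i)).
      exact: leq_bigmax.
    by rewrite /Num.bound /=; congr _.+1; rewrite normr_id.
  by exists N => // i; rewrite /g /= in_itv/= -ler_norml.
- move=> k; rewrite [X in (X < _)%E](lebesgue_rV_box (A := g k));
    last by move=> i; exact: measurable_itv.
  rewrite (eq_bigr (fun=> (fine (lam `[- k%:R, k%:R]))%:E)); last first.
    by move=> i _; rewrite fineK// lebesgue_measure_itv; case: ifP.
  by rewrite prodEFin ltry.
- move=> A mA; change (lebesgue_rV [set x : 'rV[R]_m | forall i, A i (x ord0 i)] =
    (r ^+ m)%:E * nu [set x : 'rV[R]_m | forall i, A i (x ord0 i)])%E.
  rewrite nuE.
  pose B i : set (measurableTypeR R) := (fun y => r * y + t ord0 i) @^-1` A i.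
  rewrite (_ : _ @^-1` _ = [set x : 'rV[R]_m | forall i, B i (x ord0 i)]); last first.
    by apply/seteqP; split => x /= H i; have := H i; rewrite !mxE.
  rewrite lebesgue_rV_box// [X in (_ * X)%E](lebesgue_rV_box (A := B)); last first.
    move=> i; rewrite -[X in measurable X]setTI.
    exact: measurable_affine.
  rewrite -[m in r ^+ m]card_ord -prodr_const -prodEFin -big_split/=.
  by apply: eq_bigr => i _; rewrite -(lebesgue_measure_affine (t ord0 i) r0).
Qed.

(** The measure of a box is a product, so a map acting coordinate by
    coordinate preserves Lebesgue measure on the unit cube as soon as each of
    its coordinates preserves Lebesgue measure on the unit interval. *)
Lemma lebesgue_rV_cube_map m (f : 'I_m -> R -> R) (E : set 'rV[R]_m) :
  (forall i, measurable_fun setT (f i : measurableTypeR R -> measurableTypeR R)) ->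
  (forall i (A : set (measurableTypeR R)), measurable A ->
     lam (`[0, 1[ `&` f i @^-1` A) = lam (`[0, 1[ `&` A)) ->
  measurable E ->
  lebesgue_rV (@unit_cube R m `&` (fun x => \row_i f i (x ord0 i)) @^-1` E) =
  lebesgue_rV (@unit_cube R m `&` E).
Proof.
move=> mf fP mE.
have mF : measurable_fun setT (fun x : 'rV[R]_m => \row_i f i (x ord0 i)).
  apply: measurable_fun_rV => i.
  rewrite (_ : _ \o _ = f i \o rV_coord i); last first.
    by apply/funext => x /=; rewrite /rV_coord !mxE.
  by apply: measurableT_comp; [exact: mf|exact: measurable_rV_coord].
have mC := @measurable_unit_cube R m.
have [nu nuE] := pushforward_measure (mrestr (@lebesgue_rV R m) mC) mF.
have restrE B : mrestr (@lebesgue_rV R m) mC B = lebesgue_rV (@unit_cube R m `&` B).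
  by rewrite /mrestr setIC.
rewrite -!restrE -[LHS]nuE.
have cubeE (A : 'I_m -> set (measurableTypeR R)) : (forall i, measurable (A i)) ->
  lebesgue_rV (@unit_cube R m `&` [set x : 'rV[R]_m | forall i, A i (x ord0 i)]) =
  (\prod_(i < m) lam (`[0%R, 1%R[ `&` A i))%E.
  move=> mA; rewrite -lebesgue_rV_box => [|i]; last exact: measurableI.
  congr (lebesgue_rV _); rewrite unit_cubeE; apply/seteqP; split => x /=.
    by move=> [x1 x2] i; split; [exact: x1|exact: x2].
  by move=> H; split=> i; have [] := H i.
have mpre i (A : set (measurableTypeR R)) : measurable A -> measurable (f i @^-1` A).
  by move=> mA; rewrite -[X in measurable X]setTI; exact: mf.
apply: (@eq_measure_rV _ _ _ (fun _ _ => setT)) => //.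
- by rewrite -subTset => x _; exists 0%N.
- move=> k; rewrite nuE.
  rewrite [X in (X < _)%E](restrE [set x : 'rV[R]_m | forall i, @setT R (x ord0 i)]).
  rewrite [X in (X < _)%E](cubeE (fun=> setT))// big1 ?ltry// => i _.
  rewrite setIT lebesgue_measure_itv/=.
  by rewrite lte_fin ltr01 oppr0 adde0.
- move=> A mA; rewrite nuE.
  pose B i : set (measurableTypeR R) := f i @^-1` A i.
  rewrite (_ : _ @^-1` _ = [set x : 'rV[R]_m | forall i, B i (x ord0 i)]); last first.
    by apply/seteqP; split => x /= H i; have := H i; rewrite !mxE.
  rewrite [LHS]restrE [RHS]restrE !cubeE//; last by move=> i; exact: mpre.
  by apply: eq_bigr => i _; rewrite fP.
Qed.

End euclidean_space.

(** * Fractional parts of affine maps *)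

Definition fracp (R : realType) (x : R) : R := x - (Num.floor x)%:~R.

Section fractional_part.
Context {R : realType}.
Local Notation lam := (@lebesgue_measure R).

Lemma fracp_itv (x : R) : 0 <= fracp x < 1.
Proof.
rewrite /fracp subr_ge0 floor_le/= ltrBlDl.
by have := floorD1_gt x; rewrite intrD.
Qed.

Lemma fracpD_int (x : R) (k : int) : fracp (x + k%:~R) = fracp x.
Proof. by rewrite /fracp floorDrz ?intr_int// intrKfloor intrD; ring. Qed.

Lemma fracp_id (x : R) : 0 <= x < 1 -> fracp x = x.
Proof. by move=> x01; rewrite /fracp (floor_def (m := 0)) ?subr0// add0r. Qed.

Lemma measurable_fracp :
  measurable_fun setT (@fracp R : measurableTypeR R -> measurableTypeR R).
Proof.
apply: measurable_funB; first exact: measurable_id.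
apply: nondecreasing_measurable => // x y xy.
by rewrite ler_int le_floor.
Qed.

Let preimage_shift (k : R) (A : set (measurableTypeR R)) : measurable A ->
  lam ((fun x => x + k) @^-1` A) = lam A.
Proof.
move=> mA; rewrite -(lebesgue_measure_affine k ltr01 mA) mul1e; congr (lam _).
by apply/seteqP; split => x /=; rewrite mul1r.
Qed.

(** A half-open interval of length one is, modulo integers, the unit
    interval: cut it at the integer that it contains and translate. *)
Lemma lebesgue_periodic_window (A : set (measurableTypeR R)) (u : R) :
  measurable A ->
  lam (`[u, u + 1[ `&` @fracp R @^-1` A) = lam (`[0, 1[ `&` A).
Proof.
move=> mA; set P := _ @^-1` A.
have mP : measurable P.
  by rewrite -[X in measurable X]setTI; exact: measurable_fracp.
have mI a b : measurable (`[a, b[ `&` P).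
  by apply: measurableI => //; exact: measurable_itv.
have shift a b (k : int) :
    lam (`[a, b[ `&` P) = lam (`[a - k%:~R, b - k%:~R[ `&` P).
  rewrite -(preimage_shift k%:~R (mI a b)); congr (lam _).
  apply/seteqP; split => x /=; rewrite !in_itv/= /P/= fracpD_int.
    by move=> [? ?]; split => //; lra.
  by move=> [? ?]; split => //; lra.
have {}PA : lam (`[0, 1[ `&` A) = lam (`[0, 1[ `&` P).
  congr (lam _); apply/seteqP; split => x /=; rewrite in_itv/= /P/=.
    by move=> [? ?]; split => //; rewrite fracp_id.
  by move=> [? ?]; split => //; rewrite -[x]fracp_id.
rewrite (shift _ _ (Num.floor u)) PA.
have := fracp_itv u; rewrite -/(fracp u) [X in `[_, X[](_ : _ = fracp u + 1); last first.
  by rewrite /fracp; ring.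
set v := fracp u => /andP[v0 v1].
have cut a b c : a <= b -> b <= c ->
    lam (`[a, c[ `&` P) = (lam (`[a, b[ `&` P) + lam (`[b, c[ `&` P))%E.
  move=> ab bc; have -> : `[a, c[ `&` P = (`[a, b[ `&` P) `|` (`[b, c[ `&` P).
    rewrite -setIUl; congr (_ `&` _).
    apply/seteqP; split => x /=; rewrite !in_itv/=.
      by move=> ?; case: (ltP x b) => ?; [left|right]; lra.
    by move=> [?|?]; lra.
  rewrite measureU; [by []|exact: mI|exact: mI|].
  apply/seteqP; split => // x /=; rewrite !in_itv/=.
  by move=> [[/andP[_ xb] _] [/andP[bx _] _]]; move: (lt_le_trans xb bx); rewrite ltxx.
rewrite (cut v 1); [|lra|lra]; rewrite (shift 1 _ 1%Z) (cut 0 v 1) ?(ltW v1)//.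
by rewrite subrr addrK addeC.
Qed.

(** The map [x |-> n x + t] stretches the unit interval over [n] consecutive
    windows of length one, which all carry the same part of a periodic set;
    the factor [n] is the dilation factor of the measure. *)
Lemma lebesgue_frac_affine (n : nat) (t : R) (A : set (measurableTypeR R)) :
  (0 < n)%N -> measurable A ->
  lam (`[0, 1[ `&` (fun x => fracp (n%:R * x + t)) @^-1` A) =
  lam (`[0, 1[ `&` A).
Proof.
move=> n0 mA; set P := @fracp R @^-1` A.
have mP : measurable P.
  by rewrite -[X in measurable X]setTI; exact: measurable_fracp.
have mI a b : measurable (`[a, b[ `&` P).
  by apply: measurableI => //; exact: measurable_itv.
have window k : lam (`[t, t + k%:R[ `&` P) = (k%:R%:E * lam (`[0%R, 1%R[ `&` A))%E.
  elim: k => [|k IH].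
    rewrite addr0 set_itvco0 set0I measure0 mul0e//.
  have -> : `[t, t + k.+1%:R[ `&` P =
      (`[t, t + k%:R[ `&` P) `|` (`[t + k%:R, t + k%:R + 1[ `&` P).
    rewrite -setIUl; congr (_ `&` _).
    have k0 : 0 <= k%:R :> R by [].
    apply/seteqP; split => x /=; rewrite !in_itv/= -natr1.
      by move=> ?; case: (ltP x (t + k%:R)) => ?; [left|right]; lra.
    by move=> [?|?]; lra.
  rewrite measureU; [|exact: mI|exact: mI|]; last first.
    apply/seteqP; split => // x /=; rewrite !in_itv/=.
    by move=> [[/andP[_ xb] _] [/andP[bx _] _]]; move: (lt_le_trans xb bx); rewrite ltxx.
  rewrite [X in (X + _)%E]IH [X in (_ + X)%E]lebesgue_periodic_window//.
  by rewrite -natr1 EFinD ge0_muleDl// mul1e.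
have n0' : 0 < n%:R :> R by rewrite ltr0n.
have fin : (n%:R : R) != 0 by rewrite gt_eqF.
have E : (n%:R%:E * lam (`[0%R, 1%R[ `&` (fun x => fracp (n%:R * x + t)%R) @^-1` A)
   = n%:R%:E * lam (`[0%R, 1%R[ `&` A))%E.
  rewrite -window -(lebesgue_measure_affine t n0' (mI _ _)); congr (_ * lam _)%E.
  apply/seteqP; split => x /=; rewrite !in_itv/= => -[? ?]; split => //; nra.
have := congr1 (fun z => (n%:R^-1%:E * z)%E) E.
by rewrite !muleA -EFinM mulVf// !mul1e.
Qed.

End fractional_part.

(** * The Euclidean norm *)

Section euclidean_norm.
Context {R : realType} (m : nat).
Implicit Types x y : 'rV[R]_m.

Lemma enorm_ge0 x : 0 <= enorm x.
Proof. exact: sqrtr_ge0. Qed.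

Lemma enorm_sqr x : enorm x ^+ 2 = \sum_(i < m) x ord0 i ^+ 2.
Proof. by rewrite sqr_sqrtr// sumr_ge0// => i _; exact: sqr_ge0. Qed.

Lemma enormZ (a : R) x : enorm (a *: x) = `|a| * enorm x.
Proof.
rewrite /enorm -sqrtr_sqr -sqrtrM ?sqr_ge0// mulr_sumr.
by congr Num.sqrt; apply: eq_bigr => i _; rewrite mxE exprMn.
Qed.

Lemma enormN x : enorm (- x) = enorm x.
Proof. by rewrite -scaleN1r enormZ normrN1 mul1r. Qed.

Lemma enorm_coord x i : `|x ord0 i| <= enorm x.
Proof.
rewrite -sqrtr_sqr ler_wsqrtr// (bigD1 i)//= lerDl.
by apply: sumr_ge0 => j _; exact: sqr_ge0.
Qed.

Lemma enorm_eq0_coord x i : enorm x = 0 -> x ord0 i = 0.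
Proof.
by have := enorm_coord x i => /[swap] ->; rewrite normr_le0 => /eqP.
Qed.

(** Cauchy-Schwarz, from the sum of the squares of
    [|y| x_i - |x| y_i] being nonnegative. *)
Lemma sum_mul_le_enorm x y :
  \sum_(i < m) x ord0 i * y ord0 i <= enorm x * enorm y.
Proof.
have [x0|x0] := eqVneq (enorm x) 0.
  by rewrite x0 mul0r big1// => i _; rewrite enorm_eq0_coord ?mul0r.
have [y0|y0] := eqVneq (enorm y) 0.
  by rewrite y0 mulr0 big1// => i _; rewrite [y _ _]enorm_eq0_coord ?mulr0.
have X : 0 < enorm x by rewrite lt_def x0 enorm_ge0.
have Y : 0 < enorm y by rewrite lt_def y0 enorm_ge0.
have : 0 <= \sum_(i < m) (enorm y * x ord0 i - enorm x * y ord0 i) ^+ 2.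
  by apply: sumr_ge0 => i _; exact: sqr_ge0.
rewrite (eq_bigr (fun i => enorm y ^+ 2 * x ord0 i ^+ 2 +
   (- (2 * enorm x * enorm y)) * (x ord0 i * y ord0 i) +
   enorm x ^+ 2 * y ord0 i ^+ 2)); last by move=> i _; ring.
rewrite !big_split/= -!mulr_sumr -!enorm_sqr; set s := \sum_(i < m) _ => H.
have XY := mulr_gt0 X Y; rewrite -subr_ge0 -(pmulr_rge0 _ XY); nra.
Qed.

Lemma enormD x y : enorm (x + y) <= enorm x + enorm y.
Proof.
rewrite -(@ler_pXn2r _ 2)// ?nnegrE ?enorm_ge0 ?addr_ge0 ?enorm_ge0//.
rewrite enorm_sqr (eq_bigr (fun i => x ord0 i ^+ 2 + y ord0 i ^+ 2 +
  2 * (x ord0 i * y ord0 i))); last by move=> i _; rewrite mxE; ring.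
rewrite !big_split/= -mulr_sumr -!enorm_sqr.
have := sum_mul_le_enorm x y; nra.
Qed.

Lemma enorm_le_coord x (c : R) : 0 <= c -> (forall i, `|x ord0 i| <= c) ->
  enorm x <= Num.sqrt m%:R * c.
Proof.
move=> c0 xc; rewrite -[c]ger0_norm// -sqrtr_sqr -sqrtrM// ler_wsqrtr//.
rewrite mulr_natl -[m in _ *+ m]card_ord -sumr_const; apply: ler_sum => i _.
by rewrite -[X in X <= _]real_normK ?num_real// lerXn2r ?nnegrE.
Qed.

Lemma enorm_int_lt1 x : x \is a mxOver Num.int -> enorm x < 1 -> x = 0.
Proof.
move=> /mxOverP xZ x1; apply/rowP => i; rewrite mxE.
have [k xk] := intrP (xZ ord0 i).
have := le_lt_trans (enorm_coord x i) x1.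
by rewrite xk -intr_norm ltrz1 => ?; have -> : k = 0 by lia.
Qed.

End euclidean_norm.

(** * Invariance of Haar measure on the torus *)

Section torus_section.
Context {R : realType} (m : nat).
Local Notation T := (torus R m).
Implicit Types (x y : 'rV[R]_m) (a t : T).

Definition rV_frac x : 'rV[R]_m := \row_i fracp (x ord0 i).

(** The representative in the unit cube, which depends measurably on the
    point. *)
Definition torus_rep a : 'rV[R]_m := rV_frac (repr a).

Lemma pi_torusD x y : \pi_T (x + y) = \pi_T x + \pi_T y.
Proof. exact: raddfD. Qed.

Lemma pi_torusN x : \pi_T (- x) = - \pi_T x.
Proof. exact: raddfN. Qed.

Lemma pi_torusMn x n : \pi_T (x *+ n) = \pi_T x *+ n.
Proof. exact: raddfMn. Qed.

Lemma pi_rV_frac x : \pi_T (rV_frac x) = \pi_T x.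
Proof.
apply/eqP/pi_torus_eq/mxOverP => i j; rewrite [i]ord1 !mxE /fracp addrAC subrr sub0r.
by rewrite rpredN intr_int.
Qed.

Lemma torus_repK a : \pi_T (torus_rep a) = a.
Proof. by rewrite pi_rV_frac reprK. Qed.

Lemma torus_rep_pi x : torus_rep (\pi_T x) = rV_frac x.
Proof.
apply/rowP => i; rewrite !mxE.
have /eqP/pi_torus_eq/mxOverP/(_ ord0 i) : \pi_T (repr (\pi_T x)) = \pi_T x.
  by rewrite reprK.
rewrite !mxE => /intrP[k xk]; rewrite -(fracpD_int (x ord0 i) k) -xk.
by congr fracp; ring.
Qed.

Lemma measurable_rV_frac : measurable_fun setT rV_frac.
Proof.
apply: measurable_fun_rV => i.
rewrite (_ : _ \o _ = @fracp R \o rV_coord i); last first.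
  by apply/funext => x /=; rewrite /rV_coord mxE.
by apply: measurableT_comp; [exact: measurable_fracp|exact: measurable_rV_coord].
Qed.

Lemma measurable_torus_rep : measurable_fun setT torus_rep.
Proof.
move=> _ A mA; rewrite setTI.
suff : measurable (rV_frac @^-1` A).
  rewrite (_ : _ @^-1` A = \pi_T @^-1` (torus_rep @^-1` A)).
    by rewrite -[X in measurable X]setTI.
  by apply/seteqP; split => x /=; rewrite torus_rep_pi.
by rewrite -[X in measurable X]setTI; exact: measurable_rV_frac.
Qed.

(** Multiplication by [n] is many-to-one on the torus, but it preserves Haar
    measure.  The case [n = 1] is invariance under translation. *)
Lemma haar_torus_affine (n : nat) t (A : set T) : (0 < n)%N -> measurable A ->
  haar_torus [set a | A (a *+ n + t)] = haar_torus A.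
Proof.
move=> n0 mA; rewrite /haar_torus.
have mpA : measurable (\pi_T @^-1` A).
  by rewrite -[X in measurable X]setTI; exact: measurable_pi_torus.
pose f (i : 'I_m) (y : R) := fracp (n%:R * y + torus_rep t ord0 i).
have key x : \pi_T x *+ n + t = \pi_T (\row_i f i (x ord0 i)).
  rewrite -[t in LHS]torus_repK -pi_torusMn -pi_torusD -pi_rV_frac.
  congr (\pi_T _); apply/rowP => i; rewrite [LHS]mxE [RHS]mxE /f.
  by congr fracp; rewrite [LHS]mxE mulmxnE mulr_natl.
rewrite -[RHS](lebesgue_rV_cube_map (f := f))//.
- congr (lebesgue_rV (_ `&` _)); apply/seteqP.
  by split => x /=; rewrite (key x).
- move=> i; apply: measurableT_comp; first exact: measurable_fracp.
  exact: measurable_affine.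
- by move=> i B mB; rewrite lebesgue_frac_affine.
Qed.

Definition centered_cube : set 'rV[R]_m :=
  [set x | forall i, - 2^-1 <= x ord0 i < 2^-1].

Lemma measurable_centered_cube : measurable centered_cube.
Proof.
rewrite (_ : centered_cube = [set x : 'rV[R]_m |
   forall i, (`[- 2^-1, 2^-1[%classic : set (measurableTypeR R)) (x ord0 i)]).
  by apply: (measurable_box (A := fun=> _)) => i; exact: measurable_itv.
by apply/seteqP; split => x /= + i => /(_ i); rewrite in_itv.
Qed.

(** The unit cube can be replaced by the centered one, on which the distance
    to the lattice is simply the Euclidean norm. *)
Lemma haar_torus_centered (A : set T) : measurable A ->
  haar_torus A = lebesgue_rV (centered_cube `&` \pi_T @^-1` A).
Proof.
move=> mA; pose h : 'rV[R]_m := const_mx (- 2^-1).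
have mE : measurable (centered_cube `&` \pi_T @^-1` A).
  apply: measurableI; first exact: measurable_centered_cube.
  by rewrite -[X in measurable X]setTI; exact: measurable_pi_torus.
rewrite -(haar_torus_affine (\pi_T h) (ltn0Sn 0) mA) /haar_torus.
rewrite -(lebesgue_rV_affine h ltr01 mE) expr1n mul1e; congr (lebesgue_rV _).
apply/seteqP; split => x /=; rewrite mulr1n -pi_torusD scale1r => -[xC Ax]; split => // i.
  by have := xC i; rewrite !mxE; lra.
by have := xC i; rewrite !mxE; lra.
Qed.

End torus_section.

(** * The distance to the nearest lattice point *)

Section torus_norm_facts.
Context {R : realType} (m : nat).
Local Notation T := (torus R m).
Implicit Types (x y : 'rV[R]_m) (a t : T).

Lemma mxOver_intN x : x \is a mxOver Num.int -> - x \is a mxOver Num.int.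
Proof. by move=> /mxOverP xZ; apply/mxOverP => i j; rewrite mxE rpredN. Qed.

Lemma mxOver_intD x y : x \is a mxOver Num.int -> y \is a mxOver Num.int ->
  x + y \is a mxOver Num.int.
Proof.
by move=> /mxOverP xZ /mxOverP yZ; apply/mxOverP => i j; rewrite mxE rpredD.
Qed.

Lemma torus_norm_ltP x r : torus_norm (\pi_T x) < r <->
  exists2 p, p \is a mxOver Num.int & enorm (x - p) < r.
Proof.
rewrite torus_norm_pi; have [p pZ [-> pmin]] := norm_Z_min x; split.
  by exists p.
by move=> [q qZ]; apply: le_lt_trans; exact: pmin.
Qed.

Lemma torus_norm_min x : exists2 p, p \is a mxOver Num.int &
  torus_norm (\pi_T x) = enorm (x - p).
Proof. by rewrite torus_norm_pi; have [p pZ [-> _]] := norm_Z_min x; exists p. Qed.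

Lemma torus_norm_le x : torus_norm (\pi_T x) <= enorm x.
Proof.
have [p pZ [pE pmin]] := norm_Z_min x.
by rewrite torus_norm_pi pE -[x in leRHS]subr0 pmin// mxOver0.
Qed.

Lemma torus_normN a : torus_norm (- a) = torus_norm a.
Proof.
suff H (b : T) : torus_norm (- b) <= torus_norm b.
  by apply/le_anti; rewrite H -{1}(opprK a) H.
rewrite -[b]reprK; have [p pZ ->] := torus_norm_min (repr b).
rewrite -enormN -pi_torusN -[X in _ <= enorm X](_ : - repr b - - p = _);
  last by rewrite opprB opprK addrC.
have [q qZ [qE qmin]] := norm_Z_min (- repr b).
by rewrite torus_norm_pi qE qmin// mxOver_intN.
Qed.

Lemma torus_normD a t : torus_norm (a + t) <= torus_norm a + torus_norm t.
Proof.
rewrite -[a]reprK -[t]reprK.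
have [p pZ ->] := torus_norm_min (repr a).
have [q qZ ->] := torus_norm_min (repr t).
rewrite (le_trans _ (enormD _ _))// addrACA -opprD.
have [s sZ [sE smin]] := norm_Z_min (repr a + repr t).
by rewrite -pi_torusD torus_norm_pi sE smin// mxOver_intD.
Qed.

(** Coordinatewise, no nonzero integer is closer than 0 to a number of
    absolute value at most one half. *)
Lemma torus_norm_centered x : centered_cube x -> torus_norm (\pi_T x) = enorm x.
Proof.
move=> xC; apply/le_anti; rewrite torus_norm_le/=.
have [p pZ ->] := torus_norm_min x.
apply: ler_wsqrtr; apply: ler_sum => i _; rewrite !mxE.
have [k ->] := intrP (mxOverP pZ ord0 i).
have /andP[x1 x2] := xC i.
have [->|] := eqVneq k 0; first by rewrite subr0.
rewrite neq_lt => /orP[k0|k0].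
  have : k%:~R <= (-1)%:~R :> R by rewrite ler_int; lia.
  by nra.
have : 1%:~R <= k%:~R :> R by rewrite ler_int; lia.
by nra.
Qed.

Lemma measurable_torus_norm :
  measurable_fun setT (@torus_norm R m : T -> measurableTypeR R).
Proof.
pose h : 'rV[R]_m := const_mx 2^-1.
rewrite (_ : @torus_norm R m = @enorm R m \o
    (fun x : 'rV[R]_m => 1 *: x + - h) \o @rV_frac R m \o
    (fun x : 'rV[R]_m => 1 *: x + h) \o @torus_rep R m).
  have mt (t : 'rV[R]_m) : measurable_fun setT (fun x : 'rV[R]_m => 1 *: x + t).
    exact: measurable_rV_affine.
  exact: (measurableT_comp (measurableT_comp (measurableT_comp
    (measurableT_comp (@measurable_enorm R m) (mt _)) (@measurable_rV_frac R m))
    (mt _)) (@measurable_torus_rep R m)).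
apply/funext => a /=; rewrite !scale1r -torus_norm_centered.
  by rewrite pi_torusD pi_torusN pi_rV_frac pi_torusD addrK torus_repK.
move=> i; rewrite !mxE.
by have := fracp_itv (fracp (repr a ord0 i) + 2^-1); lra.
Qed.

Lemma measurable_torus_ball r : measurable [set a : T | torus_norm a < r].
Proof.
rewrite (_ : [set a | _] = @torus_norm R m @^-1` `]-oo, r[%classic); last first.
  by apply/seteqP; split => a /=; rewrite in_itv.
by rewrite -[X in measurable X]setTI; exact: measurable_torus_norm.
Qed.

Lemma measurable_torus_affine n t : measurable_fun setT (fun a : T => a *+ n + t).
Proof.
rewrite (_ : (fun a : T => a *+ n + t) =
  (\pi_T : 'rV[R]_m -> T) \o (fun x : 'rV[R]_m => n%:R *: x + torus_rep t) \o @torus_rep R m).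
  exact: (measurableT_comp (measurableT_comp (@measurable_pi_torus R m)
    (measurable_rV_affine _ _)) (@measurable_torus_rep R m)).
by apply/funext => a /=; rewrite pi_torusD scaler_nat pi_torusMn !torus_repK.
Qed.

Lemma measurable_torus_sub2 n :
  measurable_fun setT (fun z : T * T => z.1 *+ n - z.2).
Proof.
rewrite (_ : (fun z : T * T => z.1 *+ n - z.2) = (\pi_T : 'rV[R]_m -> T) \o
  (fun z : T * T => n%:R *: torus_rep z.1 - torus_rep z.2)); last first.
  apply/funext => z /=.
  by rewrite pi_torusD pi_torusN scaler_nat pi_torusMn !torus_repK.
apply: (measurableT_comp (@measurable_pi_torus R m)).
apply: measurable_fun_rV => i.
rewrite (_ : _ \o _ = (fun z : T * T => n%:R * rV_coord i (torus_rep z.1) -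
    rV_coord i (torus_rep z.2) : measurableTypeR R)); last first.
  by apply/funext => z /=; rewrite /rV_coord [LHS]mxE [X in _ + X]mxE [X in X - _]mxE.
have mc : measurable_fun setT (@rV_coord R m i \o @torus_rep R m).
  exact: (measurableT_comp (measurable_rV_coord i) (@measurable_torus_rep R m)).
apply: measurable_funB.
  apply: measurable_funM => //.
  exact: (measurableT_comp mc measurable_fst).
exact: (measurableT_comp mc measurable_snd).
Qed.

End torus_norm_facts.

(** * Volumes of balls *)

Section ball_volume.
Context {R : realType} (m : nat).
Local Notation B := (unit_ball_volume R m).

Let mball r : measurable [set x : 'rV[R]_m | enorm x < r].
Proof.
rewrite (_ : [set x | _] = @enorm R m @^-1` `]-oo, r[%classic); last first.
  by apply/seteqP; split => x /=; rewrite in_itv.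
by rewrite -[X in measurable X]setTI; exact: measurable_enorm.
Qed.

Let mcball r : measurable [set x : 'rV[R]_m | enorm x <= r].
Proof.
rewrite (_ : [set x | _] = @enorm R m @^-1` `]-oo, r]%classic); last first.
  by apply/seteqP; split => x /=; rewrite in_itv.
by rewrite -[X in measurable X]setTI; exact: measurable_enorm.
Qed.

Lemma lebesgue_closed_ball (r : R) : 0 < r ->
  lebesgue_rV [set x : 'rV[R]_m | enorm x <= r] = (B * r ^+ m)%:E.
Proof.
move=> r0; rewrite -(lebesgue_rV_affine 0 r0 (mcball r)).
rewrite (_ : _ @^-1` _ = [set x : 'rV[R]_m | enorm x <= 1]).
  by rewrite -unit_ball_volumeE -EFinM mulrC.
have E (z : R) : (r * z <= r) = (z <= 1) by rewrite -{2}[r]mulr1 ler_pM2l.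
by apply/seteqP; split => x /=; rewrite addr0 enormZ gtr0_norm// E.
Qed.

Lemma unit_ball_volume_gt0 : (0 < m)%N -> 0 < B.
Proof.
move=> m0; have m0' : 0 < m%:R :> R by rewrite ltr0n.
rewrite -lte_fin unit_ball_volumeE.
pose A (i : 'I_m) : set (measurableTypeR R) := `[- m%:R^-1, m%:R^-1]%classic.
have mA i : measurable (A i) by exact: measurable_itv.
apply: (@lt_le_trans _ _ (lebesgue_rV [set x : 'rV[R]_m | forall i, A i (x ord0 i)])).
  rewrite lebesgue_rV_box// (eq_bigr (fun=> (m%:R^-1 + m%:R^-1)%:E)).
    by rewrite prodEFin lte_fin prodr_gt0// => i _; rewrite addr_gt0// invr_gt0.
  have mi : 0 < m%:R^-1 :> R by rewrite invr_gt0.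
  move=> i _; rewrite /A lebesgue_measure_itv/= lte_fin ifT; last by lra.
  by rewrite -EFinB opprK.
apply: le_measure; rewrite ?inE//; first exact: measurable_box.
move=> x /= xA; apply: (le_trans (@enorm_le_coord _ _ _ m%:R^-1 _ _)).
- by rewrite invr_ge0.
- by move=> i; have := xA i; rewrite /A/= in_itv/= ler_norml.
rewrite ler_pdivrMr// mul1r -[leRHS]ger0_norm ?ler0n// -sqrtr_sqr ler_wsqrtr//.
by rewrite expr2 ler_peMl// ler1n.
Qed.

(** Spheres are null because the volume scales: the open ball of radius [r]
    contains the closed balls of radius [r s] for all [s < 1]. *)
Lemma lebesgue_open_ball (r : R) : (0 < m)%N -> 0 < r ->
  lebesgue_rV [set x : 'rV[R]_m | enorm x < r] = (B * r ^+ m)%:E.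
Proof.
move=> m0 r0; have B0 := unit_ball_volume_gt0 m0.
apply/le_anti/andP; split.
  rewrite -lebesgue_closed_ball//; apply: le_measure; rewrite ?inE//.
  by move=> x /= /ltW.
have fin : lebesgue_rV [set x : 'rV[R]_m | enorm x < r] \is a fin_num.
  rewrite ge0_fin_numE//; apply: (@le_lt_trans _ _ (B * r ^+ m)%:E); last by rewrite ltry.
  rewrite -lebesgue_closed_ball//; apply: le_measure; rewrite ?inE//.
  by move=> x /= /ltW.
rewrite -[X in (_ <= X)%E]fineK//; set v := fine _; rewrite lee_fin.
have le_v s : 0 < s < 1 -> B * (r * s) ^+ m <= v.
  move=> /andP[s0 s1]; rewrite -lee_fin fineK// -lebesgue_closed_ball ?mulr_gt0//.
  apply: le_measure; rewrite ?inE// => x /= /le_lt_trans; apply.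
  by rewrite gtr_pMr.
have cv : (fun k : nat => B * (r * (1 - k.+1%:R^-1)) ^+ m) @ \oo --> B * (r * (1 - 0)) ^+ m.
  apply: cvgM; first exact: cvg_cst.
  apply: (@continuous_cvg _ _ _ _ _ _ (fun y : R => y ^+ m)); first exact: exprn_continuous.
  apply: cvgM; first exact: cvg_cst.
  apply: cvgB; first exact: cvg_cst.
  exact: cvg_harmonic.
rewrite subr0 mulr1 in cv; rewrite -(cvg_lim _ cv)//.
apply: limr_le; first by apply/cvg_ex; eexists; exact: cv.
near=> k; apply: le_v.
have k0 : (0 < k)%N by near: k; exact: nbhs_infty_gt.
apply/andP; split; first by rewrite subr_gt0 invf_lt1 ?ltr0n// ltr1n.
by rewrite ltrBlDr ltrDl invr_gt0 ltr0n.
Unshelve. all: by end_near. Qed.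

Lemma haar_ballE (r : R) : haar_torus [set a : torus R m | torus_norm a < r] =
  lebesgue_rV (@centered_cube R m `&` [set x : 'rV[R]_m | enorm x < r]).
Proof.
rewrite haar_torus_centered; last exact: measurable_torus_ball.
congr lebesgue_rV; apply/seteqP; split => x /= [xC].
  by rewrite torus_norm_centered.
by move=> xr; rewrite torus_norm_centered.
Qed.

(** The bound holds for every radius, even when the ball wraps around the
    torus; equality holds for balls contained in the centered cube. *)
Lemma haar_ball_le (r : R) : (0 < m)%N -> 0 < r ->
  (haar_torus [set a : torus R m | (torus_norm a < r)%R] <= (B * r ^+ m)%:E)%E.
Proof.
move=> m0 r0; rewrite haar_ballE -lebesgue_open_ball//.
apply: le_measure => [||x []//]; rewrite inE; last exact: mball.
by apply: measurableI; [exact: measurable_centered_cube|exact: mball].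
Qed.

Lemma haar_ball (r : R) : (0 < m)%N -> 0 < r <= 2^-1 ->
  haar_torus [set a : torus R m | torus_norm a < r] = (B * r ^+ m)%:E.
Proof.
move=> m0 /andP[r0 r1]; rewrite haar_ballE -lebesgue_open_ball//.
congr lebesgue_rV; apply/setIidPr => x /= xr i.
have := le_lt_trans (enorm_coord x i) (lt_le_trans xr r1).
by rewrite ltr_norml => /andP[/ltW -> ->].
Qed.

End ball_volume.

(** * Two simultaneous conditions with coprime multipliers *)

(** Double counting: a pointwise bound on how often the sets [F i] overlap
    inside [G] bounds the sum of their measures. *)
Lemma sum_measure_le d (T : measurableType d) (R : realType)
    (mu : {measure set T -> \bar R}) (I : Type) (s : seq I) (F : I -> set T)
    (G : set T) (K : R) :
  0 <= K -> (forall i, measurable (F i)) -> measurable G ->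
  (forall x, \sum_(i <- s) \1_(F i) x <= K * \1_G x) ->
  (\sum_(i <- s) mu (F i) <= K%:E * mu G)%E.
Proof.
move=> K0 mF mG H.
have mI (A : set T) : measurable A -> measurable_fun setT (fun x => (\1_A x)%:E : \bar R).
  by move=> mA; apply/measurable_EFinP; exact: measurable_indic.
have muE A : measurable A -> mu A = (\int[mu]_x (\1_A x)%:E)%E.
  by move=> mA; rewrite integral_indic// setIT.
rewrite (muE _ mG) -ge0_integralZl_EFin//; last exact: mI.
rewrite (eq_bigr _ (fun i _ => muE _ (mF i))).
rewrite -ge0_integral_sum//; last first.
  by move=> i; exact: mI.
apply: ge0_le_integral => //.
- by move=> x _; apply: sume_ge0 => i _; rewrite lee_fin.
- by apply: emeasurable_sum => i; exact: mI.
- by apply: measurable_funeM; exact: mI.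
- by move=> x _; rewrite sumEFin -EFinM lee_fin.
Qed.

Section torsion_grid.
Context {R : realType} (m : nat).
Local Notation T := (torus R m).
Local Notation B := (unit_ball_volume R m).
Implicit Types (b y : T).

(** If [a b] and [n b] are close to the integer vectors [p] and [q], then
    [n p - a q] is an integer vector of norm less than one, hence zero.  By
    coprimality [q] is then [n] times an integer vector, to which [b] is
    close.  So two good approximations with small multipliers come from the
    same rational point. *)
Lemma coprime_close (a n : nat) b (r s : R) :
  (0 < a <= n)%N -> coprime a n -> s <= r -> 2 * n%:R * r <= 1 ->
  torus_norm (b *+ a) < r -> torus_norm (b *+ n) < s ->
  torus_norm b < s / n%:R.
Proof.
move=> /andP[a0 an] cop sr nr; rewrite -[b]reprK; set x := repr b.
rewrite -!pi_torusMn => /torus_norm_ltP[p pZ pr] /torus_norm_ltP[q qZ qs].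
have n0 : 0 < n%:R :> R by rewrite ltr0n (leq_trans a0).
have intMn (z : 'rV[R]_m) k : z \is a mxOver Num.int -> z *+ k \is a mxOver Num.int.
  by move=> /mxOverP zZ; apply/mxOverP => i j; rewrite mulmxnE rpredMn.
have enormMn (z : 'rV[R]_m) k : enorm (z *+ k) = k%:R * enorm z.
  by rewrite -scaler_nat enormZ normr_nat.
have pq : p *+ n = q *+ a.
  apply/eqP; rewrite -subr_eq0; apply/eqP/enorm_int_lt1.
    by apply: mxOver_intD; [exact: intMn|apply: mxOver_intN; exact: intMn].
  have -> : p *+ n - q *+ a = (x *+ n - q) *+ a - (x *+ a - p) *+ n.
    by rewrite !mulrnBl -!mulrnA [(n * a)%N]mulnC opprB [RHS]addrC addrA subrK.
  rewrite (le_lt_trans (enormD _ _))// enormN !enormMn.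
  have an' : a%:R <= n%:R :> R by rewrite ler_nat.
  have : a%:R * enorm (x *+ n - q) <= n%:R * r.
    by apply: ler_pM => //; [exact: enorm_ge0|exact: ltW (lt_le_trans qs sr)].
  have : n%:R * enorm (x *+ a - p) < n%:R * r by rewrite ltr_pM2l.
  by move=> H1 H2; lra.
(* By Bezout, [u p - v q] is the integer vector [q / n]. *)
have [u v uv _] := egcdnP n a0.
rewrite (eqP cop) in uv.
apply/torus_norm_ltP; exists (p *+ u - q *+ v).
  by apply: mxOver_intD; [exact: intMn|apply: mxOver_intN; exact: intMn].
rewrite ltr_pdivlMr// mulrC -enormMn (_ : _ *+ n = x *+ n - q)//.
rewrite mulrnBl; congr (_ - _); rewrite mulrnBl -!mulrnA [(u * n)%N]mulnC mulrnA pq.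
by rewrite -mulrnA [(a * u)%N]mulnC uv mulrnDr addrAC subrr add0r.
Qed.

Definition torsion_pt n (j : {ffun 'I_m -> 'I_n}) : T :=
  \pi_T (\row_i ((j i)%:R / n%:R)).

Lemma torsion_ptMn n (j : {ffun 'I_m -> 'I_n}) : (0 < n)%N -> torsion_pt j *+ n = 0.
Proof.
move=> n0; rewrite /torsion_pt -pi_torusMn -(raddf0 (\pi_T : 'rV[R]_m -> T)).
apply/eqP/pi_torus_eq/mxOverP => i k; rewrite subr0 mulmxnE !mxE -[X in X \in _]mulr_natr.
by rewrite divfK ?pnatr_eq0 -?lt0n// natr_int.
Qed.

(** The boxes of side [1/n] based at the counted torsion points are disjoint
    and lie in a slightly larger ball, so their number is bounded by the
    volume of that ball; [sqrt m / n] bounds the diameter of a box. *)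
Lemma card_torsion_ball n y (r : R) : (0 < m)%N -> (0 < n)%N -> 0 < r ->
  #|[pred j : {ffun 'I_m -> 'I_n} | torus_norm (y + torsion_pt j) < r]|%:R <=
  n%:R ^+ m * (B * (r + Num.sqrt m%:R / n%:R) ^+ m).
Proof.
move=> m0 n0 r0; have n0' : 0 < n%:R :> R by rewrite ltr0n.
set J := [pred j | _]; set r' := r + _.
have r'0 : 0 < r' by rewrite ltr_pwDl// mulr_ge0 ?invr_ge0 ?ler0n ?sqrtr_ge0.
pose I (k : nat) : set (measurableTypeR R) := `[k%:R / n%:R, (k%:R + 1) / n%:R[%classic.
have mI k : measurable (I k) by exact: measurable_itv.
pose Q (j : {ffun 'I_m -> 'I_n}) := [set x : 'rV[R]_m | forall i, I (j i) (x ord0 i)].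
have mQ j : measurable (Q j) by apply: (measurable_box (A := fun i => I (j i))).
pose G := [set x : 'rV[R]_m | torus_norm (y + \pi_T x) < r'].
have QP j : lebesgue_rV (Q j) = ((n%:R^-1) ^+ m)%:E.
  rewrite /Q (lebesgue_rV_box (A := fun i => I (j i)))// (eq_bigr (fun=> (n%:R^-1)%:E)).
    by rewrite prodEFin prodr_const card_ord.
  move=> i _; rewrite /I lebesgue_measure_itv/= lte_fin ltr_pM2r ?invr_gt0//.
  by rewrite ltrDl ltr01 -EFinB -mulrBl addrAC subrr add0r mul1r.
have mG : measurable ((fun b => b *+ 1 + y) @^-1` [set b : T | torus_norm b < r']).
  rewrite -[X in measurable X]setTI; apply: measurable_torus_affine => //.
  exact: measurable_torus_ball.
have GP : (lebesgue_rV (@unit_cube R m `&` G) <= (B * r' ^+ m)%:E)%E.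
  apply: le_trans (haar_ball_le m0 r'0).
  rewrite -(haar_torus_affine y (ltn0Sn 0) (measurable_torus_ball r')).
  rewrite /haar_torus le_eqVlt; apply/orP; left; apply/eqP.
  congr (lebesgue_rV (_ `&` _)); apply/seteqP.
  by split => x; rewrite /G /preimage /= mulr1n addrC.
rewrite mulrC -ler_pdivrMr ?exprn_gt0// -exprVn -lee_fin (le_trans _ GP)//.
have mCG : measurable (@unit_cube R m `&` G).
  apply: measurableI; first exact: measurable_unit_cube.
  rewrite (_ : G = \pi_T @^-1` ((fun b => b *+ 1 + y) @^-1` [set b : T | torus_norm b < r'])).
    by rewrite -[X in measurable X]setTI; exact: measurable_pi_torus.
  by apply/seteqP; split => x; rewrite /G /preimage /= mulr1n addrC.
have Qfloor j x i : Q j x -> Num.floor (n%:R * x ord0 i) = (j i : nat).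
  move=> /(_ i); rewrite /I/= in_itv/= ler_pdivrMr// ltr_pdivlMr// mulrC => H.
  by apply: floor_def; rewrite intrD /= -!pmulrn.
have QG j x : j \in J -> Q j x -> (@unit_cube R m `&` G) x.
  rewrite inE => jJ Qx; split.
    move=> i; have := Qx i; rewrite /I/= in_itv/= => /andP[H1 H2]; apply/andP; split.
      by rewrite (le_trans _ H1)// divr_ge0.
    by rewrite (lt_le_trans H2)// ler_pdivrMr// mul1r natr1 ler_nat.
  rewrite /G/= (_ : y + \pi_T x = (y + torsion_pt j) +
      \pi_T (x - \row_i ((j i)%:R / n%:R))); last first.
    by rewrite pi_torusD pi_torusN addrACA subrr addr0.
  rewrite (le_lt_trans (torus_normD _ _))// ltr_leD// (le_trans (torus_norm_le _))//.
  apply: enorm_le_coord => [|i]; first by rewrite invr_ge0.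
  have := Qx i; rewrite /I/= in_itv/= mulrDl mul1r !mxE => /andP[H1 H2].
  by rewrite ger0_norm; lra.
rewrite -[leRHS]mul1e -sum1_card natr_sum mulr_suml -sumEFin.
rewrite (eq_bigr (fun j => lebesgue_rV (Q j))); last by move=> j _; rewrite QP mul1r.
rewrite -big_filter; apply: sum_measure_le => // x.
rewrite mul1r big_filter.
have [[j jJ Qj]|noj] := pselect (exists2 j, j \in J & Q j x).
  rewrite (bigD1 j)//= big1 ?addr0; last first.
    move=> k /andP[kJ kj]; rewrite indicE memNset// => Qk.
    move/negP: kj; apply; apply/eqP/ffunP => i; apply/val_inj/eqP.
    by rewrite -eqz_nat -(Qfloor _ _ i Qk) -(Qfloor _ _ i Qj).
  by rewrite !indicE !mem_set//; exact: QG jJ Qj.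
rewrite big1 // => j jJ; rewrite indicE memNset// => Qj.
by apply: noj; exists j.
Qed.

(** Multiplication by a number coprime to [n] permutes the [n]-torsion. *)
Lemma torsion_ptMl n (a : nat) : (0 < n)%N -> coprime a n ->
  exists2 f : {ffun 'I_m -> 'I_n} -> {ffun 'I_m -> 'I_n}, injective f &
    forall j, torsion_pt j *+ a = torsion_pt (f j).
Proof.
move=> n0 cop.
pose f (j : {ffun 'I_m -> 'I_n}) : {ffun 'I_m -> 'I_n} :=
  [ffun i => Ordinal (ltn_pmod (j i * a) n0)].
exists f => [j k /ffunP jk|j].
  apply/ffunP => i; apply/val_inj; have := jk i; rewrite !ffunE => /(congr1 val)/= /eqP.
  wlog : j k jk / (j i <= k i)%N.
    move=> H; case/orP: (leq_total (j i) (k i)) => ?; first exact: H.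
    by rewrite eq_sym => ?; apply/esym/H => // l; rewrite jk.
  move=> jki; rewrite eq_sym eqn_mod_dvd ?leq_mul2r ?jki ?orbT// -mulnBl.
  rewrite Gauss_dvdl 1?coprime_sym// => /dvdn_leq; rewrite subn_gt0.
  by have := ltn_ord (k i); case: ltngtP jki => //; lia.
have n0' : n%:R != 0 :> R by rewrite pnatr_eq0 -lt0n.
rewrite /torsion_pt -pi_torusMn; apply/eqP/pi_torus_eq/mxOverP => l i.
rewrite [l]ord1 !mxE mulmxnE !mxE ffunE /=.
have -> : (j i)%:R / n%:R *+ a - ((j i * a) %% n)%:R / n%:R = ((j i * a) %/ n)%:R :> R.
  rewrite -[X in X - _]mulr_natr mulrAC -mulrBl -natrM {1}(divn_eq (j i * a) n).
  by rewrite natrD addrK natrM mulfK.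
exact: natr_int.
Qed.

(** Averaging over translations by [n]-torsion points does not change
    [n b], whereas [a b] then runs over all points of a grid of mesh [1/n].
    So, given the condition on [n b], the condition on [a b] has at most the
    probability that [card_torsion_ball] allows: the two conditions are
    independent up to fattening one ball by the mesh of the grid. *)
Lemma haar_coprime_ball (a n : nat) (r s : R) :
  (0 < m)%N -> (0 < n)%N -> coprime a n -> 0 < r ->
  (haar_torus [set b : T | (torus_norm (b *+ a) < r)%R /\ (torus_norm (b *+ n) < s)%R] <=
   (B * (r + Num.sqrt m%:R / n%:R) ^+ m)%:E *
   haar_torus [set b : T | (torus_norm b < s)%R])%E.
Proof.
move=> m0 n0 cop r0; set E := [set b | _ /\ _].
have n0' : 0 < n%:R :> R by rewrite ltr0n.
have B0 : 0 < B by exact: unit_ball_volume_gt0.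
have K0 : 0 <= B * (r + Num.sqrt m%:R / n%:R) ^+ m.
  by rewrite mulr_ge0 ?(ltW B0)// exprn_ge0// addr_ge0 ?(ltW r0)// divr_ge0 ?sqrtr_ge0.
have mmul (k : nat) (u : R) : measurable [set b : T | torus_norm (b *+ k) < u].
  have := @measurable_torus_affine R m k 0 measurableT _ (measurable_torus_ball u).
  rewrite setTI; congr measurable; apply/seteqP.
  by split => b /=; rewrite addr0.
have mE : measurable E by exact: (measurableI _ _ (mmul a r) (mmul n s)).
set G := [set b : T | torus_norm (b *+ n) < s].
have GP : haar_torus G = haar_torus [set b : T | torus_norm b < s].
  rewrite -(haar_torus_affine 0 n0 (measurable_torus_ball s)); congr haar_torus.
  by apply/seteqP; split => b /=; rewrite addr0.
rewrite -GP.
have [f finj fE] := torsion_ptMl n0 cop.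
pose F (j : {ffun 'I_m -> 'I_n}) := [set b | E (b *+ 1 + torsion_pt j)].
have mF j : measurable (F j).
  by rewrite -[X in measurable X]setTI; exact: measurable_torus_affine.
have FP j : haar_torus (F j) = haar_torus E by exact: haar_torus_affine.
have nm0 : 0 < n%:R ^+ m :> R by exact: exprn_gt0.
have nK0 := mulr_ge0 (ltW nm0) K0.
rewrite -(@lee_pmul2l _ (n%:R ^+ m)%:E)// muleA -EFinM.
have -> : ((n%:R ^+ m)%:E * haar_torus E =
    \sum_(j : {ffun 'I_m -> 'I_n}) haar_torus (F j))%E.
  rewrite (eq_bigr (fun=> haar_torus E)) => [|j _]; last by rewrite FP.
  rewrite -(fineK (fin_num_measure _ _ mE)) sumEFin sumr_const card_ffun !card_ord.
  by rewrite -EFinM -natrX mulr_natl.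
apply: sum_measure_le => //; [exact: mmul|move=> b].
have [Gb|Gb] := pselect (G b); last first.
  rewrite big1 => [|j _]; first by rewrite mulr_ge0.
  rewrite indicE memNset//.
  rewrite /F/= mulr1n => -[_]; rewrite mulrnDl torsion_ptMn// addr0.
  exact: Gb.
rewrite [in leRHS]indicE mem_set// mulr1.
apply: le_trans (card_torsion_ball (b *+ a) m0 n0 r0).
rewrite (eq_bigr (fun j => if torus_norm (b *+ a + torsion_pt (f j)) < r then 1 else 0 : R)).
  rewrite -big_mkcond/= sumr_const -[X in X <= _]mulr1n ler_nat.
  rewrite -(fintype.card_image finj); apply: subset_leq_card.
  apply/fintype.subsetP => _ /fintype.imageP[j jP ->].
  by rewrite inE.
move=> j _; rewrite indicE /F /E; case: ifPn => H.
  by rewrite mem_set//= mulr1n !mulrnDl fE torsion_ptMn// addr0.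
rewrite memNset//= mulr1n !mulrnDl fE => -[].
by rewrite (negbTE H).
Qed.

End torsion_grid.

(** * Almost sure convergence along a sparse sequence *)

Section almost_sure_convergence.
Context d (T : measurableType d) (R : realType).
Variable P : probability T R.

(** A series of nonnegative functions with summable integrals has an
    integrable sum, which is finite almost everywhere. *)
Lemma ae_cvg0_of_summable (f : nat -> T -> R) (a : nat -> R) (M : R) :
  (forall k, measurable_fun setT (f k : T -> measurableTypeR R)) ->
  (forall k x, 0 <= f k x) ->
  (forall k, (\int[P]_x (f k x)%:E <= (a k)%:E)%E) ->
  (forall n, \sum_(0 <= k < n) a k <= M) ->
  {ae P, forall x, (fun k => f k x) @ \oo --> (0 : R)}.
Proof.
move=> mf f0 fa aM.
pose F x := (\sum_(k <oo) (f k x)%:E)%E.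
have mF k : measurable_fun setT (fun x => (f k x)%:E) by apply/measurable_EFinP; exact: mf.
have f0' k x : (0 <= (f k x)%:E)%E by rewrite lee_fin.
have intF : P.-integrable setT F.
  apply/integrableP; split.
    by apply: ge0_emeasurable_sum.
  rewrite (eq_integral F) => [|x _]; last first.
    by rewrite gee0_abs//; apply: nneseries_ge0.
  rewrite integral_nneseries//; apply: (@le_lt_trans _ _ M%:E); last exact: ltry.
  apply: lime_le.
    by apply: is_cvg_nneseries => k _ _; exact: integral_ge0.
  apply: nearW => n; apply: le_trans (_ : (\sum_(0 <= k < n) (a k)%:E <= _)%E).
    by apply: lee_sum => k _; exact: fa.
  by rewrite sumEFin lee_fin.
have := integrable_ae measurableT intF; apply: filterS => x /(_ Logic.I) Fx.
apply: cvg_series_cvg_0; apply: nondecreasing_is_cvgn.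
  apply/nondecreasing_seqP => n; rewrite /series/= big_nat_recr//= lerDl.
  exact: f0.
exists (fine (F x)) => _ [n _ <-]; rewrite /series/= -lee_fin -sumEFin fineK//.
by apply: nneseries_lim_ge => k _ _.
Qed.

End almost_sure_convergence.

Section harmonic_sums.
Context {R : realType}.

Definition harm (N : nat) : R := \sum_(1 <= q < N.+1) q%:R^-1.

Lemma harmS N : harm N.+1 = harm N + N.+1%:R^-1.
Proof. by rewrite /harm big_nat_recr. Qed.

Lemma lnS_bounds N : N.+2%:R^-1 <= ln (N.+2%:R : R) - ln N.+1%:R <= N.+1%:R^-1.
Proof.
have x0 : 0 < N.+1%:R :> R by rewrite ltr0n.
have y0 : 0 < N.+2%:R :> R by rewrite ltr0n.
have yx : N.+2%:R = 1 + N.+1%:R :> R by rewrite nat1r.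
apply/andP; split.
  rewrite -lerN2 opprB -ln_div ?posrE// (_ : _ / _ = 1 + - N.+2%:R^-1).
    by apply: le_ln1Dx; rewrite ltrN2 invf_lt1// ltr1n.
  by rewrite yx; move: x0; generalize (N.+1%:R : R) => x x0; field; rewrite gt_eqF//; lra.
rewrite -ln_div ?posrE// (_ : _ / _ = 1 + N.+1%:R^-1).
  by apply: le_ln1Dx; rewrite (lt_trans (ltrN10 R))// invr_gt0.
by rewrite yx mulrDl mul1r divff ?gt_eqF// addrC.
Qed.

Lemma harm_ge N : ln N.+1%:R <= harm N.
Proof.
elim: N => [|N IH]; first by rewrite /harm big_geq// ln1.
rewrite harmS; have /andP[_ H] := lnS_bounds N.
by apply: le_trans (lerD IH H); rewrite addrC subrK.
Qed.

Lemma harm_le N : (0 < N)%N -> harm N <= 1 + ln N%:R.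
Proof.
case: N => // N _; elim: N => [|N IH].
  by rewrite /harm big_nat1 invr1 ln1 addr0.
rewrite harmS; have /andP[H _] := lnS_bounds N.
by apply: (le_trans (lerD IH H)); rewrite -addrA [X in _ + X]addrC subrK.
Qed.

Lemma harm_ge1 N : (0 < N)%N -> 1 <= harm N.
Proof.
case: N => // N _; elim: N => [|N IH]; first by rewrite /harm big_nat1 invr1.
by rewrite harmS (le_trans IH)// lerDl invr_ge0.
Qed.

Lemma sum_inv_sqr_le n : \sum_(0 <= k < n) (k.+1%:R ^+ 2)^-1 <= 2 :> R.
Proof.
suff H k : \sum_(0 <= j < k.+1) (j.+1%:R ^+ 2)^-1 <= 2 - k.+1%:R^-1 :> R.
  case: n => [|n]; first by rewrite big_geq.
  by rewrite (le_trans (H n))// lerBlDr lerDl invr_ge0.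
elim: k => [|k IH]; first by rewrite big_nat1 expr1n invr1; lra.
rewrite big_nat_recr//=; apply: (le_trans (lerD IH (lexx _))).
have x0 : 0 < k.+1%:R :> R by rewrite ltr0n.
have -> : k.+2%:R = k.+1%:R + 1 :> R by rewrite natr1.
set x := k.+1%:R in x0 *; clearbody x; clear IH.
have : x^-1 - (x + 1)^-1 = (x * (x + 1))^-1 by field; rewrite !gt_eqF//; lra.
have : ((x + 1) ^+ 2)^-1 <= (x * (x + 1))^-1.
  by rewrite lef_pV2 ?posrE; nra.
move=> H1 H2; rewrite -lerBrDl -subr_ge0
  (_ : _ - _ = x^-1 - (x + 1)^-1 - (x + 1) ^- 2); last by ring.
by rewrite H2 subr_ge0.
Qed.

End harmonic_sums.

Section interpolation.
Context {R : realType}.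

(** At [N = sparse k] the logarithm is of order [k ^ 6].  With truncation
    level [D] of order [k ^ 2], the two errors of the second moment method,
    of relative size [1 / D] and [D ^ 2 / ln N], are both summable in [k];
    yet the logarithms of consecutive terms have ratio tending to one. *)
Definition sparse (k : nat) : nat := (2 ^ (k.+1 ^ 6))%N.

Lemma ln_sparse k : ln (sparse k)%:R = k.+1%:R ^+ 6 * ln 2 :> R.
Proof. by rewrite /sparse natrX lnXn// -natrX mulr_natl. Qed.

Lemma leq_sparse : {homo sparse : k l / (k <= l)%N}.
Proof. by move=> k l kl; rewrite leq_pexp2l// leq_exp2r. Qed.

Lemma sparse_gt k : (k < sparse k)%N.
Proof.
apply: (@leq_trans (2 ^ k.+1)); first exact: ltn_trans (ltnSn k) (ltn_expl _ _).
by rewrite leq_pexp2l// -[X in (X <= _)%N]expn1 leq_pexp2l.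
Qed.

Lemma sparse_index : exists kappa : nat -> nat, kappa @ \oo --> \oo /\
  forall N, (2 <= N)%N -> (sparse (kappa N) <= N < sparse (kappa N).+1)%N.
Proof.
have /choice[kappa kP] : forall N, exists k,
    (2 <= N)%N -> (sparse k <= N < sparse k.+1)%N.
  move=> N; have exN : exists k, (N < sparse k)%N by exists N; exact: sparse_gt.
  have [[|k] Nk kmin] := ex_minnP exN.
    by exists 0%N => N2; move: Nk; rewrite ltnNge N2.
  exists k => _; rewrite Nk andbT leqNgt; apply/negP => /kmin.
  by rewrite ltnn.
exists kappa; split; last exact: kP.
move=> A [K _ KA]; exists (sparse K.+1) => // N /= KN; apply: KA => /=.
have N2 : (2 <= N)%N by apply: leq_trans KN; exact: (@leq_sparse 0).
have /andP[_ H] := kP N N2; rewrite leqNgt; apply/negP => kK.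
have := leq_trans H (leq_trans (leq_sparse (leqW kK)) KN).
by rewrite ltnn.
Qed.

(** For a nondecreasing [S] and [N] between two consecutive terms of the
    sparse sequence, [S N / ln N] is squeezed between the ratios at these
    terms, up to the ratio of their logarithms, which tends to one. *)
Lemma cvg_sparse_interpolate (S : nat -> R) (c : R) : 0 < c ->
  {homo S : m n / (m <= n)%N >-> m <= n} -> (forall n, 0 <= S n) ->
  (fun k => S (sparse k) / (c * ln (sparse k)%:R)) @ \oo --> (1 : R) ->
  (fun N => S N / (c * ln N%:R)) @ \oo --> (1 : R).
Proof.
move=> c0 Sm S0 Scv; have [kappa [koo kP]] := sparse_index.
pose u k : R := S (sparse k) / (c * ln (sparse k)%:R).
pose rho k : R := (k.+2%:R / k.+1%:R) ^+ 6.
have ln2 : 0 < ln 2 :> R by rewrite ln_gt0// ltr1n.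
have rho0 k : 0 < rho k by rewrite exprn_gt0// divr_gt0.
have lnk0 k : 0 < ln (sparse k)%:R :> R by rewrite ln_sparse mulr_gt0// exprn_gt0.
have rhoE k : ln (sparse k.+1)%:R = rho k * ln (sparse k)%:R.
  by rewrite !ln_sparse /rho mulrA -exprMn divfK ?pnatr_eq0.
have rho1 : rho @ \oo --> (1 : R).
  have -> : rho = (fun k => (1 + harmonic k) ^+ 6).
    apply/funext => k; rewrite /rho /harmonic -[k.+2]addn1 natrD mulrDl divff ?pnatr_eq0//.
    by rewrite mul1r.
  rewrite -[X in _ --> X](expr1n R 6) -{2}[1]addr0.
  apply: (@continuous_cvg _ _ _ _ _ _ (fun y : R => y ^+ 6)); first exact: exprn_continuous.
  by apply: cvgD; [exact: cvg_cst|exact: cvg_harmonic].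
have uk : (u \o kappa) @ \oo --> (1 : R) by exact: (cvg_comp _ _ koo Scv).
have ukS : (fun N => u (kappa N).+1) @ \oo --> (1 : R).
  have cvS : (fun k => u k.+1) @ \oo --> (1 : R) by rewrite (cvg_shiftS u).
  exact: (cvg_comp _ _ koo cvS).
have rk : (rho \o kappa) @ \oo --> (1 : R) by exact: (cvg_comp _ _ koo rho1).
apply: (@squeeze_cvgr _ _ _ _ (fun N => u (kappa N) / rho (kappa N))
  (fun N => u (kappa N).+1 * rho (kappa N))).
- near=> N; have N2 : (2 <= N)%N by near: N; exact: nbhs_infty_ge.
  have /andP[N1 N3] := kP N N2.
  set k := kappa N in N1 N3 *.
  have lnN : ln (sparse k)%:R <= ln N%:R :> R.
    by rewrite ler_ln ?posrE ?ltr0n ?expn_gt0 ?ler_nat// (leq_trans _ N2).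
  have lnN' : ln N%:R <= ln (sparse k.+1)%:R :> R.
    by rewrite ler_ln ?posrE ?ltr0n ?expn_gt0 ?ler_nat ?(ltnW N3)// (leq_trans _ N2).
  have lnN0 : 0 < ln N%:R :> R by exact: lt_le_trans lnN.
  apply/andP; split.
    rewrite (_ : _ / rho k = S (sparse k) / (c * ln (sparse k.+1)%:R)); last first.
      by rewrite /u rhoE -mulrA -invfM -mulrA [ln _ * rho k]mulrC.
    apply: ler_pM => //; [by rewrite invr_ge0 mulr_ge0// ltW|exact: Sm|].
    by rewrite lef_pV2 ?posrE ?mulr_gt0// ler_pM2l.
  rewrite (_ : _ * rho k = S (sparse k.+1) / (c * ln (sparse k)%:R)); last first.
    by rewrite /u rhoE; field; rewrite !gt_eqF// lnk0.
  apply: ler_pM => //; [by rewrite invr_ge0 mulr_ge0// ltW|exact: Sm (ltnW N3)|].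
  by rewrite lef_pV2 ?posrE ?mulr_gt0// ler_pM2l.
- rewrite -[X in _ --> X](divr1 1); apply: cvgM => //.
  exact: cvgV.
- by rewrite -[X in _ --> X](mulr1 1); apply: cvgM.
Unshelve. all: by end_near. Qed.

End interpolation.

(** * A second moment criterion with truncation *)

Section counting_law.
Context d (T : measurableType d) (R : realType).
Variable P : probability T R.

Definition hits (A : nat -> set T) (N : nat) (x : T) : R :=
  \sum_(1 <= q < N.+1) \1_(A q) x.

Lemma measurable_hits A N : (forall q, measurable (A q)) ->
  measurable_fun setT (hits A N : T -> measurableTypeR R).
Proof. by move=> mA; apply: measurable_sum => q; exact: measurable_indic. Qed.

Lemma hits_ge0 A N x : 0 <= hits A N x.
Proof. by apply: sumr_ge0. Qed.

Lemma integral_sum_indic (I : Type) (s : seq I) (F : I -> set T) :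
  (forall i, measurable (F i)) ->
  (\int[P]_x (\sum_(i <- s) \1_(F i) x)%:E = (\sum_(i <- s) fine (P (F i)))%:E)%E.
Proof.
move=> mF; rewrite -sumEFin.
rewrite (eq_integral (fun x => (\sum_(i <- s) (\1_(F i) x)%:E)%E)); last first.
  by move=> x _; rewrite sumEFin.
rewrite ge0_integral_sum//.
  by apply: eq_bigr => i _; rewrite integral_indic// setIT fineK// fin_num_measure.
by move=> i; apply/measurable_EFinP; exact: measurable_indic.
Qed.

Lemma integral_hits A N : (forall q, measurable (A q)) ->
  (\int[P]_x (hits A N x)%:E = (\sum_(1 <= q < N.+1) fine (P (A q)))%:E)%E.
Proof. exact: integral_sum_indic. Qed.

Lemma integral_hits_sqr A N : (forall q, measurable (A q)) ->
  (\int[P]_x (hits A N x ^+ 2)%:E =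
   (\sum_(1 <= q < N.+1) \sum_(1 <= r < N.+1) fine (P (A q `&` A r)))%:E)%E.
Proof.
move=> mA.
rewrite (eq_integral (fun x =>
  (\sum_(z <- [seq (q, r) | q <- index_iota 1 N.+1, r <- index_iota 1 N.+1])
     \1_(A z.1 `&` A z.2) x)%:E)); last first.
  move=> x _; congr EFin; rewrite big_allpairs /hits expr2 mulr_suml.
  apply: eq_bigr => q _; rewrite mulr_sumr; apply: eq_bigr => r _ /=.
  by rewrite indicI.
rewrite integral_sum_indic.
  by rewrite big_allpairs.
by move=> z; exact: measurableI.
Qed.

(** Expanding the square, with the cross term moved to the other side so
    that only integrals of nonnegative functions occur. *)
Lemma integral_hits_dev A N (E : R) : (forall q, measurable (A q)) -> 0 <= E ->
  (\int[P]_x ((hits A N x - E) ^+ 2)%:E =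
   (\sum_(1 <= q < N.+1) \sum_(1 <= r < N.+1) fine (P (A q `&` A r)) + E ^+ 2
    - 2 * E * \sum_(1 <= q < N.+1) fine (P (A q)))%:E)%E.
Proof.
move=> mA E0; have mh := measurable_hits N mA.
have mEF (f : T -> R) : measurable_fun setT (f : T -> measurableTypeR R) ->
    measurable_fun setT (fun x => (f x)%:E) by move=> mf; apply/measurable_EFinP.
have mdev : measurable_fun setT (fun x => (hits A N x - E) ^+ 2 : measurableTypeR R).
  by apply: measurable_funX; exact: measurable_funB.
have EE : (\int[P]_x ((hits A N x - E) ^+ 2)%:E + (2 * E)%:E * \int[P]_x (hits A N x)%:E
   = \int[P]_x (hits A N x ^+ 2)%:E + (E ^+ 2)%:E)%E.
  have -> : ((E ^+ 2)%:E = \int[P]_x (E ^+ 2)%:E)%E.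
    by rewrite integral_cst// [X in (_ * X)%E](@probability_setT _ _ _ P) mule1.
  rewrite -ge0_integralZl_EFin//;
    [|by move=> x _; rewrite lee_fin hits_ge0|exact: mEF|by rewrite mulr_ge0].
  rewrite -!ge0_integralD//.
  - by apply: eq_integral => x _; rewrite -EFinM -!EFinD; congr EFin; ring.
  - by move=> x _; rewrite lee_fin sqr_ge0.
  - by apply: mEF; exact: measurable_funX.
  - by move=> x _; rewrite lee_fin sqr_ge0.
  - by move=> x _; rewrite lee_fin sqr_ge0.
  - exact: mEF.
  - by move=> x _; rewrite -EFinM lee_fin !mulr_ge0// hits_ge0.
  - by apply: measurable_funeM; exact: mEF.
move: EE; rewrite integral_hits_sqr// integral_hits// -EFinM -EFinD.
set I := (\int[P]_x _)%E; set a := \sum_(1 <= q < _) fine (P (A q)); set e := \sum_(1 <= q < _) _.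
move=> EE; have : (I + (2 * E * a)%:E - (2 * E * a)%:E =
  (e + E ^+ 2)%:E - (2 * E * a)%:E)%E by rewrite EE.
by rewrite addeK// -EFinB.
Qed.

(** The events [A q] have probability [c / q] for large [q], but they need
    not be close to pairwise independent.  The subevents [A' D q] lose only a
    proportion [1 / D] of the total probability, and their correlations
    exceed those of independent events by a term that is of smaller order
    than the square of the mean as long as [D ^ 2] is small compared with
    [harm N]. *)
Variables (A : nat -> set T) (A' : nat -> nat -> set T) (c C : R) (q0 : nat).
Hypothesis c0 : 0 < c.
Hypothesis C0 : 0 <= C.
Hypothesis mA : forall q, measurable (A q).
Hypothesis mA' : forall D q, measurable (A' D q).
Hypothesis A'A : forall D q, A' D q `<=` A q.
Hypothesis PA_eq : forall q, (q0 <= q)%N -> fine (P (A q)) = c / q%:R.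
Hypothesis PA' : forall D N, (0 < D)%N ->
  \sum_(1 <= q < N.+1) fine (P (A q `\` A' D q)) <= C * harm N / D%:R.
Hypothesis PAA' : forall D N, (0 < D)%N ->
  \sum_(1 <= q < N.+1) \sum_(1 <= r < N.+1) fine (P (A' D q `&` A' D r)) <=
  (c * harm N) ^+ 2 + C * D%:R ^+ 2 * harm N.

(** Only the indices below [q0] can contribute to the defect. *)
Lemma sum_PA_ge N :
  c * harm N - c * harm q0 <= \sum_(1 <= q < N.+1) fine (P (A q)).
Proof.
suff : \sum_(1 <= q < N.+1) (c / q%:R - fine (P (A q))) <= c * harm q0.
  by rewrite sumrB -mulr_sumr -/(harm N); lra.
suff [H] : \sum_(1 <= q < N.+1) (c / q%:R - fine (P (A q))) <= c * harm q0 /\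
   ((N <= q0)%N -> \sum_(1 <= q < N.+1) (c / q%:R - fine (P (A q))) <= c * harm N) by [].
have harm0 k : 0 <= harm k :> R by apply: sumr_ge0 => i _; rewrite invr_ge0.
elim: N => [|N [IH1 IH2]].
  by rewrite big_geq//; split=> [|_]; rewrite mulr_ge0// ltW.
rewrite big_nat_recr//=; have [qN|Nq] := leqP q0 N.+1.
  rewrite PA_eq// subrr addr0; split => // Nq; apply: (le_trans (IH2 (ltnW Nq))).
  by rewrite harmS mulrDr lerDl divr_ge0// ltW.
have H : \sum_(1 <= i < N.+1) (c / i%:R - fine (P (A i))) +
    (c / N.+1%:R - fine (P (A N.+1))) <= c * harm N.+1.
  rewrite harmS mulrDr lerD ?IH2 ?(ltnW (ltnW Nq))//.
  by rewrite lerBlDr lerDl fine_ge0.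
split=> //; apply: (le_trans H); rewrite ler_pM2l//.
have : {homo harm : m n / (m <= n)%N >-> m <= n :> R}.
  by apply: homo_leq => // [x y z|k]; [exact: le_trans|rewrite harmS lerDl invr_ge0].
by apply; exact: ltnW.
Qed.

(** Both terms are nonnegative, and together they control the distance of
   [hits A N x / (c * harm N)] to one. *)
Let dev D N x : R := (hits A N x - hits (A' D) N x) / (c * harm N) +
  (hits (A' D) N x / (c * harm N) - 1) ^+ 2.

Let hits_subE D N x : hits A N x - hits (A' D) N x = hits (fun q => A q `\` A' D q) N x.
Proof.
rewrite /hits -sumrB; apply: eq_bigr => q _; rewrite !indicE.
have [A'x|A'x] := pselect (A' D q x).
  have Ax := @A'A D q x A'x.
  by rewrite (mem_set Ax) (mem_set A'x) memNset ?subrr// => -[].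
rewrite (memNset A'x) subr0; congr (_ : bool)%:R; apply/idP/idP.
  by rewrite !inE.
by rewrite !inE => -[].
Qed.

Let dev_ge0 D N x : (0 < N)%N -> 0 <= dev D N x.
Proof.
move=> N0; have h1 : 0 < harm N :> R by exact: lt_le_trans (harm_ge1 N0).
rewrite addr_ge0 ?sqr_ge0// hits_subE divr_ge0 ?hits_ge0// mulr_ge0// ltW//.
Qed.

Let mdev D N : measurable_fun setT (dev D N : T -> measurableTypeR R).
Proof.
have mh := measurable_hits N mA; have mh' := measurable_hits N (mA' D).
apply: measurable_funD.
  by apply: measurable_funM => //; exact: measurable_funB.
by apply: measurable_funX; apply: measurable_funB => //; exact: measurable_funM.
Qed.

Let K : R := 3 * C / c + (C + 2 * c ^+ 2 * harm q0) / c ^+ 2.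

Let integral_dev D N : (0 < D)%N -> (0 < N)%N ->
  (\int[P]_x (dev D N x)%:E <= (K * (D%:R^-1 + D%:R ^+ 2 / harm N))%:E)%E.
Proof.
move=> D0 N0; have h1 := @harm_ge1 R _ N0; have h0 : 0 < harm N :> R by exact: lt_le_trans h1.
have D0' : 0 < D%:R :> R by rewrite ltr0n.
have D1 : 1 <= D%:R :> R by rewrite ler1n.
set E := c * harm N; have E0 : 0 < E by exact: mulr_gt0.
have mB q : measurable (A q `\` A' D q) by exact: measurableD.
have mhB := measurable_hits N mB; have mh' := measurable_hits N (mA' D).
rewrite (eq_integral (fun x => (E^-1)%:E * (hits (fun q => A q `\` A' D q) N x)%:E +
  (E ^- 2)%:E * ((hits (A' D) N x - E) ^+ 2)%:E)%E); last first.
  move=> x _; rewrite /dev hits_subE -/E -!EFinM -EFinD; congr EFin.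
  rewrite mulrC; congr (_ + _); rewrite -exprVn -exprMn; congr (_ ^+ 2).
  by rewrite mulrBr mulVf ?gt_eqF// mulrC.
have mEF (f : T -> R) : measurable_fun setT (f : T -> measurableTypeR R) ->
    measurable_fun setT (fun x => (f x)%:E) by move=> mf; apply/measurable_EFinP.
have mdv : measurable_fun setT (fun x => (hits (A' D) N x - E) ^+ 2 : measurableTypeR R).
  by apply: measurable_funX; exact: measurable_funB.
rewrite ge0_integralD//; last 4 first.
- by move=> x _; rewrite -EFinM lee_fin mulr_ge0 ?invr_ge0 ?(ltW E0)// hits_ge0.
- by apply: measurable_funeM; exact: mEF.
- by move=> x _; rewrite -EFinM lee_fin mulr_ge0 ?invr_ge0 ?sqr_ge0.
- by apply: measurable_funeM; exact: mEF.
rewrite ge0_integralZl_EFin ?invr_ge0 ?(ltW E0)//; last 2 first.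
- by move=> x _; rewrite lee_fin hits_ge0.
- exact: mEF.
rewrite ge0_integralZl_EFin ?invr_ge0 ?sqr_ge0//; last 2 first.
- by move=> x _; rewrite lee_fin sqr_ge0.
- exact: mEF.
rewrite integral_hits_dev ?(ltW E0)// integral_hits// -!EFinM -EFinD lee_fin.
have H1 := @PA' D N D0; have H2 := @PAA' D N D0.
have H3 : c * harm N - c * harm q0 - C * harm N / D%:R <= \sum_(1 <= q < N.+1) fine (P (A' D q)).
  have : \sum_(1 <= q < N.+1) fine (P (A q)) =
      \sum_(1 <= q < N.+1) fine (P (A q `\` A' D q)) + \sum_(1 <= q < N.+1) fine (P (A' D q)).
    rewrite -big_split/=; apply: eq_bigr => q _.
    rewrite -fineD ?fin_num_measure// -measureU//.
      by rewrite setUC setDUK//; exact: A'A.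
    by rewrite setDE -setIA setICl setI0.
  by have := sum_PA_ge N; lra.
move: H1 H2 H3; set s2 := \sum_(1 <= q < _) \sum_(1 <= r < _) _.
set s1 := \sum_(1 <= q < _) _; set s3 := \sum_(1 <= q < _) _ => H1 H2 H3.
have q00 : 0 <= harm q0 :> R by apply: sumr_ge0 => i _; rewrite invr_ge0.
have -> : E^-1 * s1 + E ^- 2 * (s2 + E ^+ 2 - 2 * E * s3) =
   s1 / E + (s2 + E ^+ 2 - 2 * E * s3) / E ^+ 2 by rewrite [E^-1 * _]mulrC [E ^- 2 * _]mulrC.
apply: (@le_trans _ _ (C * harm N / D%:R / E + (E ^+ 2 + C * D%:R ^+ 2 * harm N + E ^+ 2
   - 2 * E * (c * harm N - c * harm q0 - C * harm N / D%:R)) / E ^+ 2)).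
  apply: lerD; first by rewrite ler_pM2r ?invr_gt0.
  rewrite ler_pM2r ?invr_gt0 ?exprn_gt0//.
  have := ler_wpM2l (_ : 0 <= 2 * E) H3; rewrite mulr_ge0 ?(ltW E0)// => /(_ isT).
  by rewrite -/E in H2 *; lra.
have -> : C * harm N / D%:R / E + (E ^+ 2 + C * D%:R ^+ 2 * harm N + E ^+ 2
   - 2 * E * (c * harm N - c * harm q0 - C * harm N / D%:R)) / E ^+ 2 =
   3 * C / c / D%:R + (C * D%:R ^+ 2 + 2 * c ^+ 2 * harm q0) / c ^+ 2 / harm N.
  by rewrite /E; field; rewrite !gt_eqF.
have D2 : 1 <= D%:R ^+ 2 :> R by rewrite exprn_ege1.
have c2 : 0 < c ^+ 2 by rewrite exprn_gt0.
have ch : 0 <= 2 * c ^+ 2 * harm q0 by rewrite mulr_ge0// mulr_ge0// ltW.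
set g := (C + 2 * c ^+ 2 * harm q0) / c ^+ 2.
have gw : (C * D%:R ^+ 2 + 2 * c ^+ 2 * harm q0) / c ^+ 2 / harm N <=
    g * (D%:R ^+ 2 / harm N).
  rewrite [leRHS]mulrA ler_pM2r ?invr_gt0// /g [leRHS]mulrAC ler_pM2r ?invr_gt0//.
  by rewrite [leRHS]mulrDl lerD2l; apply: ler_peMr.
apply: (le_trans (lerD (lexx _) gw)).
have g0 : 0 <= g by apply: divr_ge0; [exact: addr_ge0|exact: ltW].
have a0 : 0 <= 3 * C / c by apply: divr_ge0; [exact: mulr_ge0|exact: ltW].
have w0 : 0 <= D%:R ^+ 2 / harm N :> R by apply: divr_ge0; [exact: exprn_ge0|exact: ltW].
have H4 := mulr_ge0 a0 w0.
have H5 : 0 <= g * D%:R^-1 by rewrite mulr_ge0 ?invr_ge0// ltW.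
rewrite /K -/g; set a := 3 * C / c in H4 *; set u := D%:R^-1 in H5 *.
set w := D%:R ^+ 2 / harm N in H4 *.
have -> : (a + g) * (u + w) = (a * u + g * w) + (a * w + g * u) by ring.
by rewrite lerDl addr_ge0.
Qed.

(** By the moment bounds, [dev] has summable integrals along the sparse
    sequence when the truncation level grows with [k], so it tends to zero
    almost surely; monotonicity of the counts fills the gaps. *)
Theorem ae_hits_equiv_log :
  {ae P, forall x, (fun N => hits A N x / (c * ln N%:R)) @ \oo --> (1 : R)}.
Proof.
pose D k := (k.+1 ^ 2)%N.
have K0 : 0 <= K.
  have q00 : 0 <= harm q0 :> R by apply: sumr_ge0 => i _; rewrite invr_ge0.
  by rewrite addr_ge0// divr_ge0 ?exprn_ge0 ?addr_ge0 ?mulr_ge0 ?exprn_ge0// ltW.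
have sp0 k : (0 < sparse k)%N by rewrite expn_gt0.
have ln2 : 2^-1 <= ln 2 :> R.
  by have /andP[+ _] := @lnS_bounds R 0; rewrite ln1 subr0.
have ln_sp k : k.+1%:R ^+ 6 / 2 <= ln (sparse k)%:R :> R.
  by rewrite ln_sparse ler_wpM2l// exprn_ge0.
have lnsp0 k : 0 < ln (sparse k)%:R :> R.
  by apply: lt_le_trans (ln_sp k); rewrite divr_gt0 ?exprn_gt0.
have ln_harm k : ln (sparse k)%:R <= harm (sparse k) :> R.
  apply: (le_trans _ (harm_ge _)).
  by rewrite ler_ln ?posrE ?ltr0n// ler_nat.
have harm0 k : 0 < harm (sparse k) :> R by exact: lt_le_trans (ln_harm k).
have summ : {ae P, forall x, (fun k => dev (D k) (sparse k) x) @ \oo --> (0 : R)}.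
  apply: (@ae_cvg0_of_summable _ _ _ _ _ (fun k => 3 * K * (k.+1%:R ^+ 2)^-1) (3 * K * 2)).
  - by move=> k; exact: mdev.
  - by move=> k x; exact: dev_ge0.
  - move=> k; have Dk0 : (0 < D k)%N by rewrite /D expn_gt0.
    apply: (le_trans (integral_dev Dk0 (sp0 k))).
    rewrite lee_fin (_ : 3 * K * _ = K * (3 / k.+1%:R ^+ 2)); last by ring.
    apply: ler_wpM2l => //.
    have k0 : 0 < k.+1%:R :> R by rewrite ltr0n.
    apply: (@le_trans _ _ ((k.+1%:R ^+ 2)^-1 + (k.+1%:R ^+ 2) ^+ 2 / (k.+1%:R ^+ 6 / 2))).
      rewrite /D natrX lerD2l; apply: ler_wpM2l; first by rewrite exprn_ge0.
      rewrite lef_pV2; first exact: le_trans (ln_sp k) (ln_harm k).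
        by rewrite posrE; exact: harm0.
      by rewrite posrE; apply: divr_gt0; rewrite ?exprn_gt0.
    rewrite le_eqVlt; apply/orP; left; apply/eqP.
    by move: k0; set y := k.+1%:R; move: y => y y0; field; rewrite gt_eqF.
  - move=> n; rewrite -mulr_sumr ler_wpM2l ?mulr_ge0//.
    exact: sum_inv_sqr_le.
move: summ; apply: filterS => x dev0.
apply: cvg_sparse_interpolate => //.
- apply: homo_leq => // [u v w|N]; first exact: le_trans.
  by rewrite /hits [leRHS]big_nat_recr//= lerDl.
- by move=> N; exact: hits_ge0.
have E0 k : 0 < c * harm (sparse k) by exact: mulr_gt0.
pose u k := (hits A (sparse k) x - hits (A' (D k)) (sparse k) x) / (c * harm (sparse k)).
pose v k := hits (A' (D k)) (sparse k) x / (c * harm (sparse k)) - 1.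
have u0 k : 0 <= u k by rewrite /u hits_subE divr_ge0 ?hits_ge0// ltW.
have cu : u @ \oo --> (0 : R).
  apply: (@squeeze_cvgr _ _ _ _ (fun=> 0) _ _ _ _ (cvg_cst 0) dev0).
  by apply: nearW => k; rewrite u0/= lerDl sqr_ge0.
have cv : v @ \oo --> (0 : R).
  apply/norm_cvg0P.
  have -> : (fun k => `|v k|) = (fun k => Num.sqrt (v k ^+ 2)).
    by apply/funext => k; rewrite sqrtr_sqr.
  rewrite -(sqrtr0 R); apply: (@continuous_cvg _ _ _ _ _ _ (@Num.sqrt R)).
    exact: sqrt_continuous.
  apply: (@squeeze_cvgr _ _ _ _ (fun=> 0) _ _ _ _ (cvg_cst 0) dev0).
  by apply: nearW => k; rewrite sqr_ge0/= lerDr; exact: u0.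
have ch : (fun k => harm (sparse k) / ln (sparse k)%:R) @ \oo --> (1 : R).
  apply: (@squeeze_cvgr _ _ _ _ (fun=> 1) (fun k => 1 + 2 * harmonic k)).
  - apply: nearW => k; rewrite ler_pdivlMr// mul1r ln_harm/=.
    rewrite ler_pdivrMr//; apply: (le_trans (harm_le (sp0 k))).
    rewrite mulrDl mul1r addrC lerD2l /harmonic.
    have k1 : 1 <= k.+1%:R :> R by rewrite ler1n.
    rewrite mulrAC ler_pdivlMr ?ltr0n// mul1r.
    have : k.+1%:R <= k.+1%:R ^+ 6 :> R by rewrite ler_eXnr.
    by have := ln_sp k; lra.
  - exact: cvg_cst.
  - rewrite -[X in _ --> X]addr0 -(mulr0 2); apply: cvgD; first exact: cvg_cst.
    by apply: cvgM; [exact: cvg_cst|exact: cvg_harmonic].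
have -> : (fun k => hits A (sparse k) x / (c * ln (sparse k)%:R)) =
    (fun k => (u k + v k + 1) * (harm (sparse k) / ln (sparse k)%:R)).
  by apply/funext => k; rewrite /u /v; field; rewrite !gt_eqF.
have H := cvgM (cvgD (cvgD cu cv) (cvg_cst (1 : R))) ch.
by rewrite addr0 add0r mulr1 in H; exact: H.
Qed.

End counting_law.

(** * Sums over pairs of integers and their common divisors *)

Section arithmetic_sums.
Context {R : realType}.
Implicit Types N D : nat.

Lemma ler_sum_subset (I : eqType) (s t : seq I) (F : I -> R) :
  uniq s -> uniq t -> {subset s <= t} -> (forall i, 0 <= F i) ->
  \sum_(i <- s) F i <= \sum_(i <- t) F i.
Proof.
move=> us ut st F0; rewrite [leRHS](bigID (mem s))/= -[\sum_(i <- t | i \in s) _]big_filter.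
rewrite [X in _ <= X + _](perm_big s); first by rewrite lerDl sumr_ge0.
apply: uniq_perm => // [|i]; first exact: filter_uniq.
by rewrite mem_filter; apply/andP/idP => [[]//|si]; split=> //; exact: st.
Qed.

Lemma ler_sum_inj (I J : eqType) (s : seq I) (t : seq J) (f : I -> J) (F : J -> R) :
  uniq s -> uniq t -> {in s &, injective f} -> {in s, forall i, f i \in t} ->
  (forall j, 0 <= F j) ->
  \sum_(i <- s) F (f i) <= \sum_(j <- t) F j.
Proof.
move=> us ut finj ft F0; rewrite -(big_map f xpredT F); apply: ler_sum_subset => //.
  by rewrite map_inj_in_uniq.
by move=> _ /mapP[i si ->]; exact: ft.
Qed.

(** A pair [(q, r)] is recovered from its gcd and the two cofactors, so a sum
    over pairs is a subsum of a sum over triples. *)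
Lemma ler_sum_gcd N (F : nat -> nat -> nat -> R) : (forall d a n, 0 <= F d a n) ->
  \sum_(1 <= q < N.+1) \sum_(1 <= r < N.+1)
     F (gcdn q r) (q %/ gcdn q r)%N (r %/ gcdn q r)%N <=
  \sum_(1 <= d < N.+1) \sum_(1 <= a < N.+1) \sum_(1 <= n < N.+1) F d a n.
Proof.
move=> F0; set I := index_iota 1 N.+1.
have uI : uniq I by exact: iota_uniq.
pose s := [seq (q, r) | q <- I, r <- I].
pose t := [seq (d, z) | d <- I, z <- [seq (a, n) | a <- I, n <- I]].
pose f (z : nat * nat) := let g := gcdn z.1 z.2 in (g, (z.1 %/ g, z.2 %/ g)%N).
pose G (w : nat * (nat * nat)) := F w.1 w.2.1 w.2.2.
have -> : \sum_(1 <= q < N.+1) \sum_(1 <= r < N.+1)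
     F (gcdn q r) (q %/ gcdn q r)%N (r %/ gcdn q r)%N = \sum_(z <- s) G (f z).
  by rewrite big_allpairs.
have -> : \sum_(1 <= d < N.+1) \sum_(1 <= a < N.+1) \sum_(1 <= n < N.+1) F d a n =
    \sum_(w <- t) G w.
  by rewrite big_allpairs; apply: eq_bigr => d _; rewrite big_allpairs.
apply: ler_sum_inj => //.
- by apply: allpairs_uniq => // -[? ?] [? ?] _ _ [-> ->].
- apply: allpairs_uniq => //; last by move=> -[? ?] [? ?] _ _ [-> ->].
  by apply: allpairs_uniq => // -[? ?] [? ?] _ _ [-> ->].
- move=> [q r] [q' r'] _ _ [/= eg eq er].
  rewrite -(divnK (dvdn_gcdl q r)) -[r in (_, r)](divnK (dvdn_gcdr q r)) eq er eg.
  by rewrite (divnK (dvdn_gcdl q' r')) (divnK (dvdn_gcdr q' r')).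
- move=> _ /allpairsP[[q r]/= [qI rI ->]].
  move: qI rI; rewrite !mem_index_iota => /andP[q0 qN] /andP[r0 rN].
  have g0 : (0 < gcdn q r)%N by rewrite gcdn_gt0 q0.
  apply/allpairsP; exists (gcdn q r, (q %/ gcdn q r, r %/ gcdn q r)%N) => /=; split => //.
    by rewrite mem_index_iota g0 (leq_ltn_trans (dvdn_leq _ (dvdn_gcdl _ _))).
  apply/allpairsP; exists (q %/ gcdn q r, r %/ gcdn q r)%N => /=; split => //;
    rewrite mem_index_iota divn_gt0// dvdn_leq ?dvdn_gcdl ?dvdn_gcdr//=.
    exact: leq_ltn_trans (leq_div _ _) qN.
  exact: leq_ltn_trans (leq_div _ _) rN.
- by move=> w; exact: F0.
Qed.

Lemma ler_sum_divisors N (F : nat -> nat -> R) : (forall d e, 0 <= F d e) ->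
  \sum_(1 <= q < N.+1) \sum_(1 <= d < q.+1 | (d %| q)%N) F d (q %/ d)%N <=
  \sum_(1 <= d < N.+1) \sum_(1 <= e < N.+1) F d e.
Proof.
move=> F0; set I := index_iota 1 N.+1.
have uI : uniq I by exact: iota_uniq.
pose s := [seq z <- [seq (q, d) | q <- I, d <- I] | (z.2 %| z.1)%N].
pose t := [seq (d, e) | d <- I, e <- I].
pose f (z : nat * nat) := (z.2, (z.1 %/ z.2)%N).
pose G (w : nat * nat) := F w.1 w.2.
have -> : \sum_(1 <= d < N.+1) \sum_(1 <= e < N.+1) F d e = \sum_(w <- t) G w.
  by rewrite big_allpairs.
apply: (@le_trans _ _ (\sum_(z <- s) G (f z))).
  rewrite [leRHS]big_filter [leRHS]big_mkcond [leRHS]big_allpairs/= big_seq [leRHS]big_seq.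
  apply: ler_sum => q; rewrite mem_index_iota => /andP[q0 qN].
  rewrite [leLHS]big_mkcond /I [leRHS](big_cat_nat (n := q.+1))//= lerDl.
  by apply: sumr_ge0 => d _; case: ifP => // _; exact: F0.
apply: ler_sum_inj => //.
- by apply/filter_uniq/allpairs_uniq => // -[? ?] [? ?] _ _ [-> ->].
- by apply: allpairs_uniq => // -[? ?] [? ?] _ _ [-> ->].
- move=> [q d] [q' d']; rewrite !mem_filter/= => /andP[dq _] /andP[dq' _] [/= dd qq].
  by subst d'; rewrite -(divnK dq) qq divnK.
- move=> [q d]; rewrite mem_filter/= => /andP[dq /allpairsP[[q' d']/= [qI dI [? ?]]]].
  subst q' d'; apply/allpairsP; exists (d, (q %/ d)%N); split => //=.
  move: qI dI; rewrite !mem_index_iota => /andP[q0 qN] /andP[d0 dN].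
  by rewrite divn_gt0// dvdn_leq//= (leq_ltn_trans (leq_div _ _)).
- by move=> w; exact: F0.
Qed.

(** Telescoping, by [1 / (N + 1) ^ 2 <= 1 / N - 1 / (N + 1)]. *)
Lemma sum_inv_sqr_tail N D : (0 < D)%N ->
  \sum_(1 <= d < N.+1) (if (D < d)%N then (d%:R ^+ 2)^-1 else 0) <= D%:R^-1 :> R.
Proof.
move=> D0; suff : \sum_(1 <= d < N.+1) (if (D < d)%N then (d%:R ^+ 2)^-1 else 0) <=
    (if (D <= N)%N then D%:R^-1 - N%:R^-1 else 0) :> R.
  move=> /le_trans; apply; case: ifP => _; last by rewrite invr_ge0.
  by rewrite lerBlDr lerDl invr_ge0.
elim: N => [|N IH]; first by rewrite big_geq// leqNgt D0.
rewrite big_nat_recr//= ltnS; move: IH; set s := \sum_(1 <= d < _) _ => IH.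
have [DN|ND] := leqP D N; last first.
  rewrite (leqNgt D N) ND/= in IH; rewrite addr0 (le_trans IH)//.
  by case: ifP => // DN; have -> : D = N.+1 by [lia]; rewrite subrr.
rewrite DN in IH; rewrite (leq_trans DN)//.
apply: (le_trans (lerD IH (lexx _))); rewrite -addrA lerD2l.
have x0 : 0 < N%:R :> R by rewrite ltr0n (leq_trans D0).
rewrite -natr1; set x := N%:R in x0 *; clearbody x.
rewrite addrC -subr_ge0.
have -> : - (x + 1)^-1 - ((x + 1) ^- 2 - x^-1) = (x * (x + 1) ^+ 2)^-1.
  by field; rewrite !gt_eqF//; lra.
by rewrite invr_ge0 mulr_ge0 ?exprn_ge0//; lra.
Qed.

Definition invsqrt (n : nat) : R := (Num.sqrt n%:R)^-1.

Lemma invsqrt_ge0 n : 0 <= invsqrt n.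
Proof. by rewrite invr_ge0 sqrtr_ge0. Qed.

Lemma invsqrtM k n : invsqrt (k * n) = invsqrt k * invsqrt n.
Proof. by rewrite /invsqrt natrM sqrtrM// invfM. Qed.

(** Telescoping, by [1 / sqrt (n + 1) <= 2 (sqrt (n + 1) - sqrt n)]. *)
Lemma sum_invsqrt_le n : \sum_(1 <= a < n.+1) invsqrt a <= 2 * Num.sqrt n%:R.
Proof.
elim: n => [|n IH]; first by rewrite big_geq// sqrtr0 mulr0.
rewrite big_nat_recr//=; apply: (le_trans (lerD IH (lexx _))); rewrite /invsqrt.
have yx : Num.sqrt n.+1%:R ^+ 2 = Num.sqrt n%:R ^+ 2 + 1 :> R.
  by rewrite !sqr_sqrtr// natr1.
have x0 : 0 <= Num.sqrt n%:R :> R by exact: sqrtr_ge0.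
have y0 : 0 < Num.sqrt n.+1%:R :> R by rewrite sqrtr_gt0.
set x := Num.sqrt n%:R in x0 yx *; set y := Num.sqrt n.+1%:R in y0 yx *.
clearbody x y.
rewrite -(ler_pM2r y0) mulrDl mulVf ?gt_eqF//; nra.
Qed.

(** Telescoping against [- 2 / sqrt n]. *)
Lemma sum_invsqrt_div_le n : \sum_(1 <= d < n.+1) invsqrt d / d%:R <= 3.
Proof.
suff H k : \sum_(1 <= d < k.+2) invsqrt d / d%:R <= 3 - 2 * invsqrt k.+1.
  case: n => [|n]; first by rewrite big_geq.
  by rewrite (le_trans (H n))// lerBlDr lerDl mulr_ge0// invsqrt_ge0.
elim: k => [|k IH]; first by rewrite big_nat1 /invsqrt sqrtr1 invr1 !mulr1; lra.
rewrite big_nat_recr//=; apply: (le_trans (lerD IH (lexx _))); rewrite /invsqrt.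
have yx : Num.sqrt k.+2%:R ^+ 2 = Num.sqrt k.+1%:R ^+ 2 + 1 :> R.
  by rewrite !sqr_sqrtr// natr1.
have x0 : 0 < Num.sqrt k.+1%:R :> R by rewrite sqrtr_gt0.
have y0 : 0 < Num.sqrt k.+2%:R :> R by rewrite sqrtr_gt0.
have yk : k.+2%:R = Num.sqrt k.+2%:R ^+ 2 :> R by rewrite sqr_sqrtr.
rewrite [X in _ + _ / X <= _]yk; move: x0 y0 yx.
set x := Num.sqrt k.+1%:R; set y := Num.sqrt k.+2%:R; clear yk.
clearbody x y => x0 y0 yx.
have xy : x <= y by nra.
rewrite -addrA lerD2l -subr_ge0.
have -> : - (2 / y) - (- (2 / x) + y^-1 / y ^+ 2) =
   (2 * y ^+ 2 * (y - x) - x) / (x * y ^+ 3) by field; rewrite !gt_eqF.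
apply: divr_ge0; last by rewrite mulr_ge0 ?exprn_ge0 ?ltW.
have : (y - x) * (y + x) = 1 by nra.
by nra.
Qed.

(** A symmetric double sum is controlled by bounds on the pairs [q <= r];
    the diagonal is thereby counted twice. *)
Lemma sum_pairs_le N (F G e : nat -> nat -> R) :
  (forall q r, F q r = F r q) -> (forall q r, G q r = G r q) ->
  (forall q r, 0 <= e q r) ->
  (forall q r, (0 < q <= r)%N -> (r <= N)%N -> F q r <= G q r + e q r) ->
  \sum_(1 <= q < N.+1) \sum_(1 <= r < N.+1) F q r <=
  \sum_(1 <= q < N.+1) \sum_(1 <= r < N.+1) G q r +
  2 * \sum_(1 <= q < N.+1) \sum_(1 <= r < N.+1) (if (q <= r)%N then e q r else 0).
Proof.
move=> FC GC e0 FG.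
set u := fun q r => if (q <= r)%N then e q r else 0.
have u0 q r : 0 <= u q r by rewrite /u; case: ifP.
have -> : 2 * \sum_(1 <= q < N.+1) \sum_(1 <= r < N.+1) u q r =
  \sum_(1 <= q < N.+1) \sum_(1 <= r < N.+1) (u q r + u r q).
  rewrite mulr2n mulrDl mul1r [X in _ + X = _]exchange_big/= -big_split/=.
  by apply: eq_bigr => q _; rewrite -big_split.
rewrite -big_split/= big_seq [leRHS]big_seq; apply: ler_sum => q.
rewrite mem_index_iota => /andP[q0 qN].
rewrite -big_split/= big_seq [leRHS]big_seq; apply: ler_sum => r.
rewrite mem_index_iota => /andP[r0 rN].
have [qr|rq] := leqP q r.
  have H : F q r <= G q r + u q r by rewrite /u qr; apply: FG => //; rewrite q0.
  by apply: (le_trans H); rewrite lerD2l lerDl.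
have H : F q r <= G q r + u r q.
  by rewrite FC GC /u (ltnW rq); apply: FG => //; rewrite r0 ltnW.
by apply: (le_trans H); rewrite lerD2l lerDr.
Qed.

End arithmetic_sums.

(** * The approximation radius *)

Section approximation_function.
Context {R : realType} (m : nat) (b : R).
Hypothesis m0 : (0 < m)%N.
Hypothesis b0 : 0 < b.

Definition psi (q : nat) : R := b * q%:R `^ (- m%:R^-1).

Lemma psi_gt0 q : (0 < q)%N -> 0 < psi q.
Proof. by move=> q0; rewrite mulr_gt0// powR_gt0// ltr0n. Qed.

Lemma psiX q : (0 < q)%N -> psi q ^+ m = b ^+ m / q%:R.
Proof.
move=> q0; rewrite /psi exprMn -[X in _ * X]powR_mulrn ?powR_ge0// -powRrM.
by rewrite mulNr mulVf ?pnatr_eq0 -?lt0n// powR_inv1.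
Qed.

Lemma psi_le q r : (0 < q <= r)%N -> psi r <= psi q.
Proof.
move=> /andP[q0 qr]; rewrite /psi ler_pM2l// !powRN lef_pV2 ?posrE ?powR_gt0 ?ltr0n//.
  by rewrite ge0_ler_powR ?nnegrE ?invr_ge0// ler_nat.
exact: leq_trans qr.
Qed.

Lemma psi_le_b q : (0 < q)%N -> psi q <= b.
Proof.
move=> q0; apply: (le_trans (psi_le (_ : (0 < 1 <= q)%N))) => //.
by rewrite /psi powR1 mulr1.
Qed.

Lemma psi_small : exists2 q0, (0 < q0)%N & forall q, (q0 <= q)%N -> psi q <= 2^-1.
Proof.
exists (Num.bound ((2 * b) ^+ m)).+1 => // q qb.
have q0 : (0 < q)%N by exact: leq_trans qb.
rewrite -(@ler_pXn2r _ m)// ?nnegrE ?(ltW (psi_gt0 q0))// psiX//.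
rewrite ler_pdivrMr ?ltr0n// -ler_pdivrMl ?exprn_gt0// -exprVn invrK -exprMn.
apply: ltW; apply: (lt_le_trans (archi_boundP _)); first by rewrite exprn_ge0// mulr_ge0// ltW.
by rewrite ler_nat ltnW.
Qed.

Lemma exprD_le (x y : R) k : 0 <= x -> 0 <= y ->
  (x + y) ^+ k <= x ^+ k + k%:R * y * (x + y) ^+ k.-1.
Proof.
move=> x0 y0; case: k => [|k]; first by rewrite !expr0 mul0r mul0r addr0.
rewrite -lerBlDl subrXX addrAC subrr add0r /=.
rewrite [leRHS]mulrAC [leRHS]mulrC; apply: ler_wpM2l => //.
have -> : k.+1%:R * (x + y) ^+ k = \sum_(i < k.+1) (x + y) ^+ k.
  by rewrite sumr_const card_ord mulr_natl.
apply: ler_sum => i _.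
have le_k : (i <= k)%N by rewrite -ltnS.
rewrite -[X in _ <= _ ^+ X](subnK le_k) exprD.
apply: ler_wpM2l; first by rewrite exprn_ge0// addr_ge0.
by rewrite lerXn2r ?nnegrE ?addr_ge0// lerDl.
Qed.

Definition overlap_const : R :=
  m%:R * Num.sqrt m%:R * (1 + 2 * Num.sqrt m%:R) ^+ m.-1 *
  Num.sqrt (2 * b ^+ m.-1 * b ^+ m).

Lemma overlap_const_ge0 : 0 <= overlap_const.
Proof.
by rewrite !mulr_ge0 ?sqrtr_ge0// exprn_ge0// addr_ge0// mulr_ge0// sqrtr_ge0.
Qed.

(** How much is lost by fattening the ball of radius [psi q] by the mesh of
    the grid of [n]-torsion points.  The loss is of order
    [psi q ^ (m - 1) / n], whose square is, up to a constant,
    [psi q ^ (m - 1) / (n * psi q)] times [1 / (q * n)]; the hypothesis on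
    [n] bounds the first factor. *)
Lemma psi_fattened_le q n : (0 < q)%N -> (0 < n)%N -> 1 < 2 * n%:R * psi q ->
  (psi q + Num.sqrt m%:R / n%:R) ^+ m <= b ^+ m / q%:R + overlap_const * invsqrt (q * n).
Proof.
move=> q0 n0; have p0 := psi_gt0 q0; have pm := psiX q0; have pb := psi_le_b q0.
set p := psi q in p0 pm pb *; clearbody p => np.
have n0' : 0 < n%:R :> R by rewrite ltr0n.
have q0' : 0 < q%:R :> R by rewrite ltr0n.
set s := Num.sqrt m%:R; have s0 : 0 <= s by exact: sqrtr_ge0.
have sn0 : 0 <= s / n%:R by rewrite divr_ge0// ltW.
have fat : p + s / n%:R <= (1 + 2 * s) * p.
  rewrite [leRHS](_ : _ = p + s * (2 * p)); last by ring.
  rewrite lerD2l; apply: ler_wpM2l => //.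
  by rewrite -[_^-1]mul1r ler_pdivrMr//; nra.
apply: (le_trans (exprD_le _ (ltW p0) sn0)); rewrite pm lerD2l.
have key : p ^+ m.-1 / n%:R <= Num.sqrt (2 * b ^+ m.-1 * b ^+ m) * invsqrt (q * n).
  rewrite -[leLHS]ger0_norm ?divr_ge0 ?exprn_ge0 ?(ltW p0) ?(ltW n0')// -sqrtr_sqr.
  rewrite /invsqrt -sqrtrV ?ler0n// -sqrtrM; last first.
    by rewrite mulr_ge0 ?exprn_ge0 ?mulr_ge0 ?exprn_ge0// ltW.
  rewrite ler_wsqrtr// natrM.
  rewrite (_ : (p ^+ m.-1 / n%:R) ^+ 2 = p ^+ m.-1 * (b ^+ m) / (n%:R * p) / (q%:R * n%:R)).
    rewrite ler_pM2r ?invr_gt0 ?mulr_gt0//.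
    rewrite ler_pdivrMr ?mulr_gt0//.
    have H1 : p ^+ m.-1 <= b ^+ m.-1 by rewrite lerXn2r ?nnegrE// ltW.
    have H2 : 0 <= p ^+ m.-1 * b ^+ m by rewrite mulr_ge0 ?exprn_ge0// ltW.
    have H3 : p ^+ m.-1 * b ^+ m <= b ^+ m.-1 * b ^+ m by rewrite ler_wpM2r// exprn_ge0// ltW.
    by nra.
  have -> : b ^+ m = p ^+ m * q%:R by rewrite pm divfK// gt_eqF.
  have -> : p ^+ m = p * p ^+ m.-1 by rewrite -exprS prednK.
  by field; rewrite !gt_eqF.
rewrite /overlap_const -!mulrA; apply: ler_wpM2l => //.
apply: ler_wpM2l => //.
apply: (@le_trans _ _ (n%:R^-1 * ((1 + 2 * s) ^+ m.-1 * p ^+ m.-1))).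
  apply: ler_wpM2l; first by rewrite invr_ge0.
  rewrite -exprMn lerXn2r// nnegrE; first by rewrite addr_ge0// ltW.
  by rewrite mulr_ge0 ?addr_ge0 ?mulr_ge0// ltW.
rewrite [leLHS]mulrCA; apply: ler_wpM2l.
  by rewrite exprn_ge0// addr_ge0// mulr_ge0.
by rewrite mulrC [2 * (_ * _)]mulrA.
Qed.

End approximation_function.

(** * Overlaps in the homogeneous problem *)

Section homogeneous.
Context {R : realType} (m : nat) (b : R).
Hypothesis m0 : (0 < m)%N.
Hypothesis b0 : 0 < b.
Local Notation T := (torus R m).
Local Notation B := (unit_ball_volume R m).
Local Notation psi := (@psi R m b).
Local Notation P := (@haar_torus R m).
Implicit Types (q r n d D : nat) (a t : T).

Let B0 : 0 < B. Proof. exact: unit_ball_volume_gt0. Qed.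

Lemma measurable_mul_ball n (u : R) : measurable [set a : T | torus_norm (a *+ n) < u].
Proof.
have := @measurable_torus_affine R m n 0 measurableT _ (measurable_torus_ball u).
rewrite setTI; congr measurable; apply/seteqP.
by split => a /=; rewrite addr0.
Qed.

Lemma haar_mul_ball n (u : R) : (0 < n)%N ->
  P [set a | torus_norm (a *+ n) < u] = P [set a | torus_norm a < u].
Proof.
move=> n0; rewrite -(haar_torus_affine 0 n0 (measurable_torus_ball u)).
by congr haar_torus; apply/seteqP; split => a /=; rewrite addr0.
Qed.

Lemma fine_le_measure (A C : set T) : measurable A -> measurable C ->
  A `<=` C -> fine (P A) <= fine (P C).
Proof.
move=> mA mC AC; apply: fine_le; rewrite ?fin_num_measure//.
by apply: le_measure; rewrite ?inE.
Qed.

Lemma fine_mul_ball_le n (u : R) : (0 < n)%N -> 0 < u ->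
  fine (P [set a | torus_norm (a *+ n) < u]) <= B * u ^+ m.
Proof.
move=> n0 u0; rewrite haar_mul_ball// -lee_fin fineK ?haar_ball_le//.
by rewrite fin_num_measure//; exact: measurable_torus_ball.
Qed.

Definition hom_set q : set T := [set a | torus_norm (a *+ q) < psi q].

(** For [d] dividing [q], the points of [hom_set q] whose approximating
    integer vector is divisible by [d]: they are close to a rational point of
    denominator [q / d]. *)
Definition imprimitive_set q d : set T :=
  [set a | torus_norm (a *+ (q %/ d)) < psi q / d%:R].

(** Removing these for large [d] is what makes the second moment method work
    when [m = 1]: a point that is very close to a rational of small
    denominator [s] lies in [hom_set q] for very many multiples [q] of
    [s]. *)
Definition hom_trunc D q : set T := hom_set q `\`
  \bigcup_(d in [set d | (d %| q) && (D < d)]%N) imprimitive_set q d.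

Let c : R := b ^+ m * B.

Let c0 : 0 < c. Proof. by rewrite mulr_gt0// exprn_gt0. Qed.

Lemma measurable_hom_set q : measurable (hom_set q).
Proof. exact: measurable_mul_ball. Qed.

Lemma measurable_hom_trunc D q : measurable (hom_trunc D q).
Proof.
apply: measurableD; first exact: measurable_hom_set.
by apply: bigcup_measurable => d _; exact: measurable_mul_ball.
Qed.

Lemma hom_trunc_sub D q : hom_trunc D q `<=` hom_set q.
Proof. by move=> a []. Qed.

Lemma ball_psi q : (0 < q)%N -> B * psi q ^+ m = c / q%:R.
Proof. by move=> q0; rewrite psiX// /c mulrCA mulrA. Qed.

Lemma fine_hom_set_le q : (0 < q)%N -> fine (P (hom_set q)) <= c / q%:R.
Proof. by move=> q0; rewrite -ball_psi//; apply: fine_mul_ball_le => //; exact: psi_gt0. Qed.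

Lemma fine_hom_set_eq : exists q0, forall q, (q0 <= q)%N ->
  fine (P (hom_set q)) = c / q%:R.
Proof.
have [q0 q00 q0P] := psi_small m0 b0; exists q0 => q q0q.
have q0' : (0 < q)%N by exact: leq_trans q0q.
by rewrite /hom_set haar_mul_ball// haar_ball// ?psi_gt0 ?q0P//= ball_psi.
Qed.

(** A union bound over the divisors [d > D] of [q]; dividing the radius by
    [d] divides the measure of a ball by [d ^ m >= d]. *)
Lemma fine_hom_truncD D q : (0 < q)%N ->
  fine (P (hom_set q `\` hom_trunc D q)) <=
  \sum_(1 <= d < q.+1 | (d %| q)%N) (if (D < d)%N then c / q%:R / d%:R else 0).
Proof.
move=> q0.
pose F d : set T := if (d %| q)%N && (D < d)%N then imprimitive_set q d else set0.
have mF d : measurable (F d).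
  by rewrite /F; case: ifP => // _; exact: measurable_mul_ball.
have sub : hom_set q `\` hom_trunc D q `<=` \big[setU/set0]_(d < q.+1) F d.
  move=> a [Aa]; rewrite /hom_trunc not_andE => -[//|/contrapT[d /= /andP[dq Dd] Ca]].
  rewrite -bigcup_mkord; exists d => /=; first by rewrite ltnS dvdn_leq.
  by rewrite /F dq Dd.
have mU : measurable (\big[setU/set0]_(d < q.+1) F d).
  by apply: bigsetU_measurable => d _.
apply: (@le_trans _ _ (\sum_(d < q.+1) fine (P (F d)))).
  apply: (le_trans (fine_le_measure _ mU sub)).
    by apply: measurableD; [exact: measurable_hom_set|exact: measurable_hom_trunc].
  rewrite -lee_fin fineK ?fin_num_measure// -sumEFin.
  apply: (le_trans (Boole_inequality _ _)) => //.
  by rewrite le_eqVlt; apply/orP; left; apply/eqP/eq_bigr => d _; rewrite fineK ?fin_num_measure.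
rewrite -(big_mkord xpredT (fun d => fine (P (F d)))) big_ltn//.
rewrite /F [(D < 0)%N]ltn0 andbF measure0 add0r [leRHS]big_mkcond/=.
rewrite big_seq [leRHS]big_seq; apply: ler_sum => d; rewrite mem_index_iota => /andP[d0 _].
case: ifP => /= [/andP[dq Dd]|]; last first.
  by case: (d %| q)%N => //=; [move=> ->; rewrite measure0|rewrite measure0].
rewrite dq Dd; apply: (le_trans (fine_mul_ball_le _ _)).
- by rewrite divn_gt0// dvdn_leq.
- by rewrite divr_gt0 ?psi_gt0 ?ltr0n.
rewrite exprMn mulrA ball_psi// ler_wpM2l ?divr_ge0 ?(ltW c0)//.
rewrite exprVn lef_pV2 ?posrE ?exprn_gt0 ?ltr0n//.
by rewrite ler_eXnr// ler1n.
Qed.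

Lemma sum_hom_truncD D N : (0 < D)%N ->
  \sum_(1 <= q < N.+1) fine (P (hom_set q `\` hom_trunc D q)) <= c * harm N / D%:R.
Proof.
move=> D0; pose F (d e : nat) : R := if (D < d)%N then c * (d%:R ^+ 2)^-1 * e%:R^-1 else 0.
apply: (@le_trans _ _ (\sum_(1 <= q < N.+1) \sum_(1 <= d < q.+1 | (d %| q)%N) F d (q %/ d)%N)).
  rewrite big_seq [leRHS]big_seq; apply: ler_sum => q; rewrite mem_index_iota => /andP[q0 _].
  apply: (le_trans (fine_hom_truncD _ q0)).
  rewrite big_seq_cond [leRHS]big_seq_cond.
  apply: ler_sum => d /andP[]; rewrite mem_index_iota => /andP[d0 _] dq.
  rewrite /F; case: ifP => // _.
  have d0' : d%:R != 0 :> R by rewrite pnatr_eq0 -lt0n.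
  have qd0 : (q %/ d)%:R != 0 :> R by rewrite pnatr_eq0 -lt0n divn_gt0// dvdn_leq.
  rewrite -[X in c / X%:R](divnK dq) natrM le_eqVlt; apply/orP; left; apply/eqP.
  by field; rewrite d0' qd0.
apply: (le_trans (ler_sum_divisors _ _)).
  by move=> d e; rewrite /F; case: ifP => // _; rewrite !mulr_ge0 ?invr_ge0 ?exprn_ge0// ltW.
rewrite (eq_bigr (fun d => (if (D < d)%N then (d%:R ^+ 2)^-1 else 0) * (c * harm N))).
  rewrite -mulr_suml mulrC; apply: ler_wpM2l; last exact: sum_inv_sqr_tail.
  by rewrite mulr_ge0 ?(ltW c0)// sumr_ge0// => q _; rewrite invr_ge0.
move=> d _; rewrite /F /harm mulr_sumr; case: ifP => _; last by rewrite mul0r big1.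
by rewrite mulr_sumr; apply: eq_bigr => e _; ring.
Qed.

Let K : R := c * B * overlap_const m b.

Let K0 : 0 <= K.
Proof. by rewrite mulr_ge0 ?overlap_const_ge0// mulr_ge0 ?(ltW c0)// ltW. Qed.

(** In terms of [d = gcdn q r] and of the cofactors [a] and [n] of [q] and
    [r]: what must be added to the product of the measures. *)
Definition overlap_err D (d a n : nat) : R :=
  (if (n <= D)%N then c / (d * n)%:R else 0) + K / (d * n)%:R * invsqrt (d * a * n).

(** There are three cases.  If the cofactor [n] of [r] is at most [D], the
    measure of one set is a sufficient bound, as such pairs are rare.  If
    [n] is larger than [D] but small compared with [1 / psi q], then
    [coprime_close] shows that the points of the intersection are
    approximated by the same rational point for [q] and for [r], and so are
    removed by the truncation: the intersection is empty.  Otherwise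
    [haar_coprime_ball], applied to the multiple by the gcd, shows that the
    two sets are almost independent. *)
Lemma hom_overlap D q r : (0 < q <= r)%N ->
  fine (P (hom_trunc D q `&` hom_trunc D r)) <= c / q%:R * (c / r%:R) +
  overlap_err D (gcdn q r) (q %/ gcdn q r) (r %/ gcdn q r).
Proof.
move=> /andP[q0 qr]; have r0 : (0 < r)%N by exact: leq_trans qr.
set g := gcdn q r; set a := (q %/ g)%N; set n := (r %/ g)%N.
have g0 : (0 < g)%N by rewrite gcdn_gt0 q0.
have qE : q = (g * a)%N by rewrite mulnC divnK// dvdn_gcdl.
have rE : r = (g * n)%N by rewrite mulnC divnK// dvdn_gcdr.
have a0 : (0 < a)%N by rewrite divn_gt0// dvdn_leq// dvdn_gcdl.
have n0 : (0 < n)%N by rewrite divn_gt0// dvdn_leq// dvdn_gcdr.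
have an : (a <= n)%N by exact: leq_div2r.
have cop : coprime a n.
  by rewrite /coprime -(eqn_pmul2l g0) muln_gcdr -qE -rE muln1.
have q0' : 0 < q%:R :> R by rewrite ltr0n.
have r0' : 0 < r%:R :> R by rewrite ltr0n.
have cr0 : 0 <= c / r%:R by rewrite divr_ge0 ?(ltW c0) ?(ltW r0').
have cq0 : 0 <= c / q%:R by rewrite divr_ge0 ?(ltW c0) ?(ltW q0').
have mqr : measurable (hom_trunc D q `&` hom_trunc D r).
  by apply: measurableI; exact: measurable_hom_trunc.
have e20 : 0 <= K / r%:R * invsqrt (g * a * n).
  by rewrite mulr_ge0 ?invsqrt_ge0// divr_ge0 ?K0// ltW.
rewrite /overlap_err -rE -qE; rewrite -qE in e20; have [nD|Dn] := leqP n D.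
  apply: (@le_trans _ _ (c / r%:R)).
    apply: (le_trans _ (fine_hom_set_le r0)).
    apply: fine_le_measure => //; first exact: measurable_hom_set.
    by move=> x [_ []].
  by rewrite addrA -addrAC lerDr addr_ge0// mulr_ge0.
rewrite add0r.
have [np|np] := leP (2 * n%:R * psi q) 1.
  suff -> : hom_trunc D q `&` hom_trunc D r = set0.
    by rewrite measure0 addr_ge0// mulr_ge0.
  apply/seteqP; split => // x [[xq _] [xr noC]]; apply: noC; exists n => /=.
    by rewrite Dn andbT {1}rE dvdn_mull.
  rewrite /imprimitive_set/= {1}rE mulnK//.
  apply: (coprime_close (r := psi q) (a := a)) => //.
  - by rewrite a0.
  - by apply: psi_le => //; rewrite q0.
  - by rewrite -mulrnA -qE.
  - by rewrite -mulrnA -rE.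
pose E := [set x : T | torus_norm (x *+ a) < psi q /\ torus_norm (x *+ n) < psi r].
have mE : measurable E by
  exact: (measurableI _ _ (measurable_mul_ball _ _) (measurable_mul_ball _ _)).
have mgE : measurable [set x : T | E (x *+ g + 0)].
  by rewrite -[X in measurable X]setTI; exact: measurable_torus_affine.
apply: (@le_trans _ _ (fine (P E))).
  rewrite -(haar_torus_affine 0 g0 mE).
  apply: fine_le_measure => // x [[xq _] [xr _]].
  by rewrite /E/= addr0 -!mulrnA -qE -rE; split.
have := haar_coprime_ball (psi r) m0 n0 cop (psi_gt0 m b0 q0).
have mball : measurable [set x : T | torus_norm x < psi r] by exact: measurable_torus_ball.
rewrite -/E -(fineK (fin_num_measure P _ mE)) -(fineK (fin_num_measure P _ mball)) -EFinM lee_fin.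
move=> /le_trans; apply.
have br : fine (P [set x | torus_norm x < psi r]) <= c / r%:R.
  by rewrite -ball_psi// -lee_fin fineK ?fin_num_measure// haar_ball_le// psi_gt0.
have := psi_fattened_le m0 b0 q0 n0 np.
set X := (psi q + _) ^+ m => HX.
have X0 : 0 <= X by rewrite exprn_ge0// addr_ge0 ?(ltW (psi_gt0 _ _ _))// divr_ge0 ?sqrtr_ge0.
apply: (@le_trans _ _ (B * X * (c / r%:R))).
  by apply: ler_wpM2l => //; rewrite mulr_ge0// ltW.
apply: (@le_trans _ _ (B * (b ^+ m / q%:R + overlap_const m b * invsqrt (q * n)) * (c / r%:R))).
  by apply: ler_wpM2r => //; apply: ler_wpM2l => //; exact: ltW.
rewrite le_eqVlt; apply/orP; left; apply/eqP.
by rewrite /K /c; field; rewrite !gt_eqF.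
Qed.

End homogeneous.

(** * The homogeneous law *)

Section homogeneous_law.
Context {R : realType} (m : nat) (b : R).
Hypothesis m0 : (0 < m)%N.
Hypothesis b0 : 0 < b.
Local Notation T := (torus R m).
Local Notation B := (unit_ball_volume R m).
Local Notation P := (@haar_torus R m).

Let c : R := b ^+ m * B.
Let K : R := c * B * overlap_const m b.

Let B0 : 0 < B. Proof. exact: unit_ball_volume_gt0. Qed.
Let c0 : 0 < c. Proof. by rewrite mulr_gt0// exprn_gt0. Qed.
Let K0 : 0 <= K.
Proof. by rewrite mulr_ge0 ?overlap_const_ge0// mulr_ge0 ?(ltW c0)// ltW. Qed.

Lemma overlap_err_ge0 D d a n : 0 <= overlap_err m b D d a n.
Proof.
rewrite addr_ge0//; first by case: ifP => // _; rewrite divr_ge0// ltW.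
by rewrite mulr_ge0 ?invsqrt_ge0// divr_ge0.
Qed.

(** In terms of gcd and cofactors both parts of the error are products, which
    can be summed one variable at a time: first over [a <= n], then over
    [n], then over the gcd. *)
Lemma sum_overlap_err D N : (0 < D)%N ->
  \sum_(1 <= q < N.+1) \sum_(1 <= r < N.+1) (if (q <= r)%N then
    overlap_err m b D (gcdn q r) (q %/ gcdn q r) (r %/ gcdn q r) else 0) <=
  (c + 6 * K) * D%:R * harm N.
Proof.
move=> D0; have D1 : 1 <= D%:R :> R by rewrite ler1n.
have H0 : 0 <= harm N :> R by apply: sumr_ge0 => q _; rewrite invr_ge0.
pose F d a n : R := if (a <= n)%N then overlap_err m b D d a n else 0.
have F0 d a n : 0 <= F d a n by rewrite /F; case: ifP => // _; exact: overlap_err_ge0.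
apply: (@le_trans _ _ (\sum_(1 <= q < N.+1) \sum_(1 <= r < N.+1)
     F (gcdn q r) (q %/ gcdn q r)%N (r %/ gcdn q r)%N)).
  apply: ler_sum => q _; apply: ler_sum => r _; case: ifP => [qr|_]; last exact: F0.
  by rewrite /F leq_div2r.
apply: (le_trans (ler_sum_gcd _ F0)).
have inner d n : (0 < d)%N -> (0 < n <= N)%N -> \sum_(1 <= a < N.+1) F d a n <=
    (if (n <= D)%N then c / d%:R else 0) + 2 * K * (invsqrt d / d%:R) / n%:R.
  move=> d0 /andP[n0 nN].
  have d0' : d%:R != 0 :> R by rewrite pnatr_eq0 -lt0n.
  have n0' : n%:R != 0 :> R by rewrite pnatr_eq0 -lt0n.
  have -> : \sum_(1 <= a < N.+1) F d a n = \sum_(1 <= a < n.+1) overlap_err m b D d a n.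
    rewrite (big_cat_nat (n := n.+1))//= [X in _ + X]big_nat_cond [X in _ + X]big1 ?addr0.
      rewrite big_nat_cond [RHS]big_nat_cond; apply: eq_bigr => a /andP[/andP[_ an] _].
      by rewrite /F -ltnS an.
    by move=> a /andP[/andP[na _] _]; rewrite /F leqNgt na.
  rewrite /overlap_err big_split/=; apply: lerD.
    rewrite big_const_nat subn1/= iter_addr_0; case: ifP => _; last by rewrite mul0rn.
    rewrite natrM -mulr_natr le_eqVlt; apply/orP; left; apply/eqP.
    by rewrite /c; field; rewrite d0' n0'.
  have -> : \sum_(1 <= a < n.+1) K / (d * n)%:R * invsqrt (d * a * n) =
     K / (d * n)%:R * (invsqrt d * invsqrt n) * \sum_(1 <= a < n.+1) invsqrt a.
    by rewrite mulr_sumr; apply: eq_bigr => a _; rewrite !invsqrtM; ring.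
  have k0 : 0 <= K / (d * n)%:R * (invsqrt d * invsqrt n).
    by apply: mulr_ge0; [rewrite divr_ge0|rewrite mulr_ge0 ?invsqrt_ge0].
  apply: (le_trans (ler_wpM2l k0 (sum_invsqrt_le n))).
  have nn : invsqrt n * Num.sqrt n%:R = 1 :> R.
    by rewrite mulVf// sqrtr_eq0 -ltNge ltr0n.
  rewrite natrM le_eqVlt; apply/orP; left; apply/eqP.
  rewrite (_ : K / (d%:R * n%:R) * (invsqrt d * invsqrt n) * (2 * Num.sqrt n%:R) =
    (invsqrt n * Num.sqrt n%:R) * (2 * K * invsqrt d / (d%:R * n%:R))); last by ring.
  by rewrite nn; field; rewrite d0' n0'.
apply: (@le_trans _ _ (\sum_(1 <= d < N.+1)
    (c * D%:R / d%:R + 2 * K * harm N * (invsqrt d / d%:R)))).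
  rewrite big_nat_cond [leRHS]big_nat_cond; apply: ler_sum => d /andP[/andP[d0 _] _].
  rewrite exchange_big/=.
  apply: (@le_trans _ _ (\sum_(1 <= n < N.+1)
     ((if (n <= D)%N then c / d%:R else 0) + 2 * K * (invsqrt d / d%:R) / n%:R))).
    rewrite big_nat_cond [leRHS]big_nat_cond; apply: ler_sum => n /andP[n0 _].
    exact: inner.
  rewrite big_split/=; apply: lerD.
    suff /le_trans : \sum_(1 <= n < N.+1) (if (n <= D)%N then c / d%:R else 0) <=
       c / d%:R * (minn N D)%:R.
      apply; rewrite [leRHS]mulrAC; apply: ler_wpM2l; first by rewrite divr_ge0// ltW.
      by rewrite ler_nat geq_minr.
    elim: N {H0 inner d0} => [|N IH]; first by rewrite big_geq// min0n mulr0.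
    rewrite big_nat_recr//=; apply: (le_trans (lerD IH (lexx _))).
    case: ifPn => ND.
      by rewrite (minn_idPl ND) (minn_idPl (ltnW ND)) -natr1 mulrDr mulr1.
    rewrite addr0 -ltnNge ltnS in ND *; rewrite (minn_idPr ND) (minn_idPr (leqW ND)).
    by [].
  by rewrite -mulr_sumr -/(harm N) [leRHS]mulrAC.
rewrite big_split/= -!mulr_sumr -/(harm N).
have H1 : 2 * K * harm N * \sum_(1 <= d < N.+1) (invsqrt d / d%:R) <= 6 * K * harm N.
  apply: (@le_trans _ _ (2 * K * harm N * 3)); last first.
    by rewrite le_eqVlt; apply/orP; left; apply/eqP; ring.
  by apply: ler_wpM2l (sum_invsqrt_div_le N); rewrite mulr_ge0// mulr_ge0.
apply: (le_trans (lerD (lexx _) H1)).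
have -> : (c + 6 * K) * D%:R * harm N = c * D%:R * harm N + 6 * K * harm N * D%:R by ring.
by rewrite lerD2l ler_peMr// mulr_ge0// mulr_ge0.
Qed.

Lemma hits_countE d (S : measurableType d) (A : nat -> set S) (p : pred nat) (x : S) N :
  (forall q, p q = (x \in A q)) -> (count p (iota 1 N))%:R = hits R A N x.
Proof.
move=> pA; rewrite -sum1_count natr_sum /hits /index_iota subn1 big_mkcond/=.
by apply: eq_bigr => q _; rewrite indicE pA; case: (_ \in _).
Qed.

Theorem ae_hom_count : {ae P, forall a : T,
  (fun N => (hom_count b N a)%:R / (c * ln N%:R)) @ \oo --> (1 : R)}.
Proof.
have [q0 q0P] := @fine_hom_set_eq R m b m0 b0.
have cK : 0 <= c + 6 * K by apply: addr_ge0; [exact: ltW|rewrite mulr_ge0].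
have C0 : 0 <= c + 2 * (c + 6 * K).
  by apply: addr_ge0; [exact: ltW|rewrite mulr_ge0].
have harm0 N : 0 <= harm N :> R by apply: sumr_ge0 => q _; rewrite invr_ge0.
have := @ae_hits_equiv_log _ T R P (hom_set b) (hom_trunc b) c (c + 2 * (c + 6 * K)) q0
  c0 C0 (@measurable_hom_set _ _ _) (@measurable_hom_trunc _ _ _)
  (@hom_trunc_sub _ _ _) q0P.
move=> H; have {}H := H _ _; apply: filterS (H _ _).
- move=> a; have -> // : (fun N => (hom_count b N a)%:R / (c * ln N%:R)) =
      (fun N => hits R (hom_set b) N a / (c * ln N%:R)).
  apply/funext => N.
  rewrite -(hits_countE (p := fun q => torus_norm (a *+ q) < b * q%:R `^ (- m%:R^-1)))//.
  by move=> q; apply/idP/idP; rewrite inE.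
- move=> D N D0; apply: (le_trans (sum_hom_truncD m0 b0 N D0)).
  by rewrite ler_wpM2r ?invr_ge0// ler_wpM2r// lerDl mulr_ge0.
- move=> D N D0.
  apply: (le_trans (sum_pairs_le (G := fun q r => c / q%:R * (c / r%:R))
    (e := fun q r => overlap_err m b D (gcdn q r) (q %/ gcdn q r) (r %/ gcdn q r)) _ _ _ _)).
  + by move=> q r; rewrite setIC.
  + by move=> q r; rewrite mulrC.
  + by move=> q r; exact: overlap_err_ge0.
  + by move=> q r qr _; exact: hom_overlap.
  apply: lerD.
    rewrite /harm expr2 mulr_sumr mulr_suml le_eqVlt; apply/orP; left; apply/eqP.
    by apply: eq_bigr => q _; rewrite mulr_sumr.
  apply: (le_trans (ler_wpM2l (ler0n _ 2) (sum_overlap_err N D0))).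
  have D1 : 1 <= D%:R :> R by rewrite ler1n.
  have -> : 2 * ((c + 6 * K) * D%:R * harm N) = 2 * (c + 6 * K) * D%:R * harm N.
    by rewrite -!(mulrA 2).
  apply: ler_wpM2r => //.
  have DD : D%:R <= D%:R ^+ 2 :> R by rewrite ler_eXnr.
  have H2 : 2 * (c + 6 * K) * D%:R <= 2 * (c + 6 * K) * D%:R ^+ 2.
    by apply: ler_wpM2l => //; rewrite mulr_ge0.
  apply: (le_trans H2); apply: ler_wpM2r; first by rewrite exprn_ge0.
  by rewrite lerDr ltW.
Qed.

End homogeneous_law.

(** * The inhomogeneous law *)

Lemma ae_product_sections d1 d2 (T1 : measurableType d1) (T2 : measurableType d2)
    (R : realType) (P1 : probability T1 R) (P2 : probability T2 R)
    (Q : T1 * T2 -> Prop) :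
  {ae (P1 \x P2)%E, forall z, Q z} ->
  {ae P1, forall x, {ae P2, forall y, Q (x, y)}}.
Proof.
move=> [A [mA A0 QA]].
have ms := measurable_fun_xsection P2 mA.
have : (\int[P1]_x `|P2 (xsection A x)| = 0)%E.
  rewrite -[RHS]A0 /product_measure1/=.
  by apply: eq_integral => x _; rewrite gee0_abs.
move=> /(ae_eq_integral_abs _ measurableT (f := fun x => P2 (xsection A x))) H.
have {}H := H ms; apply: filterS H => x /(_ Logic.I) /= Ax0.
exists (xsection A x); split => //; first exact: measurable_xsection.
by move=> y Qy; rewrite /xsection/= inE; exact: QA.
Qed.

Section inhomogeneous.
Context {R : realType} (m : nat) (b : R).
Hypothesis m0 : (0 < m)%N.
Hypothesis b0 : 0 < b.
Local Notation T := (torus R m).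
Local Notation B := (unit_ball_volume R m).
Local Notation psi := (@psi R m b).
Local Notation P := (@haar_torus R m).
Local Notation PP := (P \x P)%E.
Local Notation ball u := [set a : T | torus_norm a < u].
Implicit Types (q r n k D : nat) (a t v : T).

Let c : R := b ^+ m * B.
Let B0 : 0 < B. Proof. exact: unit_ball_volume_gt0. Qed.
Let c0 : 0 < c. Proof. by rewrite mulr_gt0// exprn_gt0. Qed.

Definition inhom_set q : set (T * T) := [set z | torus_norm (z.1 *+ q - z.2) < psi q].

Lemma measurable_sub_ball q (u : R) :
  measurable [set z : T * T | torus_norm (z.1 *+ q - z.2) < u].
Proof.
have := @measurable_torus_sub2 R m q measurableT _ (measurable_torus_ball u).
by rewrite setTI.
Qed.

Lemma measurable_inhom_set q : measurable (inhom_set q).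
Proof. exact: measurable_sub_ball. Qed.

Lemma haar_translate (A : set T) t : measurable A -> P [set v | A (v + t)] = P A.
Proof. by move=> mA; rewrite -(haar_torus_affine t (ltn0Sn 0) mA). Qed.

Lemma torus_norm_subC a v : torus_norm (a - v) = torus_norm (v - a).
Proof. by rewrite -torus_normN opprB. Qed.

Lemma inhom_setE q : PP (inhom_set q) = P (ball (psi q)).
Proof.
rewrite /product_measure1/= (eq_integral (fun=> P (ball (psi q)))).
  by rewrite integral_cst// [X in (_ * X)%E](@probability_setT _ _ _ P) mule1.
move=> a _ /=; rewrite -(haar_translate (- (a *+ q)) (measurable_torus_ball _)).
congr (P _); apply/seteqP; split => v; rewrite /xsection/= inE /inhom_set/= torus_norm_subC//.
Qed.

(** Substituting [v = w + q a] in the fibre over [a], the conditions become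
    one on [w] alone and one on [(r - q) a - w]; for fixed [w] the latter has
    the measure of a ball, because multiplication by [r - q > 0] and
    translations preserve Haar measure. *)
Lemma inhom_set_independent q r : (q < r)%N ->
  PP (inhom_set q `&` inhom_set r) = (P (ball (psi q)) * P (ball (psi r)))%E.
Proof.
move=> qr; set k := (r - q)%N; have k0 : (0 < k)%N by rewrite subn_gt0.
have mb u : measurable (ball u) by exact: measurable_torus_ball.
pose E : set (T * T) := (setT `*` ball (psi q)) `&` [set z | torus_norm (z.1 *+ k - z.2) < psi r].
have mE : measurable E.
  by apply: measurableI; [exact: measurableX|exact: measurable_sub_ball].
transitivity (PP E).
  rewrite /product_measure1/=; apply: eq_integral => a _ /=.
  have mV : measurable (xsection (inhom_set q `&` inhom_set r) a).
    by apply: measurable_xsection; apply: measurableI; exact: measurable_inhom_set.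
  rewrite -(haar_translate (a *+ q) mV); congr (P _).
  have sub v : a *+ r - (v + a *+ q) = a *+ k - v.
    have rE : r = (k + q)%N by rewrite subnK// ltnW.
    by rewrite rE mulrnDr opprD addrACA subrr addr0.
  have sub' v : a *+ q - (v + a *+ q) = - v by rewrite opprD addrCA subrr addr0.
  apply/seteqP; split => v; rewrite /xsection/= !inE /E /inhom_set/= sub sub' torus_normN.
    by move=> [? ?]; split.
  by move=> [[_ ?] ?]; split.
have -> : PP E = (\int[P]_v (P (ysection E v)))%E.
  transitivity ((P \x^ P)%E E); last by [].
  apply: product_measure_unique => // A1 A2 mA1 mA2.
  exact: product_measure2E.
rewrite (eq_integral (fun v => P (ball (psi r)) * (\1_(ball (psi q)) v)%:E)%E); last first.
  move=> v _; rewrite indicE /=; have [vq|vq] := pselect (ball (psi q) v).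
    rewrite mem_set// mule1 -(haar_torus_affine (- v) k0 (mb (psi r))); congr (P _).
    apply/seteqP; split => a; rewrite /ysection/= inE /E/=; first by move=> [].
    by move=> ?; split.
  rewrite memNset// mule0 -(measure0 P); congr (P _).
  by apply/seteqP; split => a //; rewrite /ysection/= inE => -[[_ /=]] /vq.
rewrite ge0_integralZl//; last by apply/measurable_EFinP; exact: measurable_indic.
by rewrite integral_indic// setIT muleC.
Qed.

(** Pairwise independence makes truncation superfluous: the criterion is
    applied to the sets themselves, with the diagonal as only error. *)
Theorem ae_inhom_count : {ae P, forall a : T, {ae P, forall v : T,
  (fun N => (inhom_count b N a v)%:R / (c * ln N%:R)) @ \oo --> (1 : R)}}.
Proof.
apply: (@ae_product_sections _ _ _ _ R P P (fun z =>
  (fun N => (inhom_count b N z.1 z.2)%:R / (c * ln N%:R)) @ \oo --> (1 : R))).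
have C0 : 0 <= 2 * c by rewrite mulr_ge0// ltW.
have harm0 N : 0 <= harm N :> R by apply: sumr_ge0 => q _; rewrite invr_ge0.
have mball u : measurable (ball u) by exact: measurable_torus_ball.
have [q0 q00 q0P] := psi_small m0 b0.
have ball_eq q : (0 < q)%N -> fine (P (ball (psi q))) <= c / q%:R.
  move=> q1; rewrite -(ball_psi b m0 q1) -lee_fin fineK ?fin_num_measure//.
  by rewrite haar_ball_le// psi_gt0.
have eqq q : (q0 <= q)%N -> fine (PP (inhom_set q)) = c / q%:R.
  move=> q0q; have q1 : (0 < q)%N by exact: leq_trans q0q.
  by rewrite inhom_setE haar_ball// ?psi_gt0 ?q0P//= ball_psi.
have H := @ae_hits_equiv_log _ (T * T)%type R PP inhom_set (fun=> inhom_set) c (2 * c) q0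
  c0 C0 measurable_inhom_set (fun=> measurable_inhom_set) (fun _ _ _ x => x) eqq.
have {}H := H _ _; apply: filterS (H _ _).
- move=> z; have -> // : (fun N => (inhom_count b N z.1 z.2)%:R / (c * ln N%:R)) =
      (fun N => hits R inhom_set N z / (c * ln N%:R)).
  apply/funext => N.
  rewrite -(hits_countE (p := fun q => torus_norm (z.1 *+ q - z.2) < b * q%:R `^ (- m%:R^-1)))//.
  by move=> q; apply/idP/idP; rewrite inE.
- move=> D N D0; rewrite big1 => [|q _].
    by rewrite divr_ge0// mulr_ge0.
  by rewrite setDv measure0.
- move=> D N D0.
  pose e q r : R := if q == r then c / r%:R else 0.
  have e0 q r : 0 <= e q r by rewrite /e; case: ifP => // _; rewrite divr_ge0// ltW.
  have cq0 q : 0 <= c / q%:R by rewrite divr_ge0// ltW.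
  apply: (le_trans (sum_pairs_le (G := fun q r => c / q%:R * (c / r%:R)) (e := e) _ _ e0 _)).
  + by move=> q r; rewrite setIC.
  + by move=> q r; rewrite mulrC.
  + move=> q r /andP[q1 qr] _; have r1 : (0 < r)%N by exact: leq_trans qr.
    rewrite /e; have [->|qr'] := eqVneq q r.
      rewrite setIid [X in fine X <= _]inhom_setE (le_trans (ball_eq _ r1))// lerDr.
      by rewrite mulr_ge0.
    rewrite [X in fine X <= _]inhom_set_independent; last by rewrite ltn_neqAle qr'.
    by rewrite fineM ?fin_num_measure// addr0 ler_pM ?ball_eq// fine_ge0.
  apply: lerD.
    rewrite /harm expr2 mulr_sumr mulr_suml le_eqVlt; apply/orP; left; apply/eqP.
    by apply: eq_bigr => q _; rewrite mulr_sumr.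
  have -> : \sum_(1 <= q < N.+1) \sum_(1 <= r < N.+1)
      (if (q <= r)%N then e q r else 0) = c * harm N.
    rewrite /harm mulr_sumr big_nat_cond [RHS]big_nat_cond.
    apply: eq_bigr => q /andP[qN _].
    rewrite (bigD1_seq q) ?mem_index_iota ?iota_uniq//= leqnn /e eqxx big1 ?addr0// => r rq.
    by case: ifP => // _; rewrite eq_sym (negbTE rq).
  rewrite mulrA; apply: ler_wpM2r => //.
  by rewrite ler_peMr// exprn_ege1// ler1n.
Qed.

End inhomogeneous.

Theorem corollary1p7 (R : realType) (m : nat) (m_ge1 : (1 <= m)%N) :
  (forall b : R, 0 < b ->
     {ae @haar_torus R m, forall alpha : torus R m,
        (fun N : nat => (hom_count b N alpha)%:R /
           (b ^+ m * unit_ball_volume R m * ln N%:R)) @ \oo --> (1 : R)}) /\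
  (forall b : R, 0 < b ->
     {ae @haar_torus R m, forall alpha : torus R m,
        {ae @haar_torus R m, forall v : torus R m,
           (fun N : nat => (inhom_count b N alpha v)%:R /
              (b ^+ m * unit_ball_volume R m * ln N%:R)) @ \oo --> (1 : R)}}).
Proof.
by split=> b b0; [exact: ae_hom_count|exact: ae_inhom_count].
Qed.
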